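(* Assume $ef>1$ and $q>3$. Let $$\tau := \frac{\mathrm{ind}_{IZ}^G \mathbf 1}{(\mathrm{Im}\, T_{1,2},\ \mathrm{Ker}\, T_{1,2})}.$$ Then (the images in $\tau$ of) the elements $$[\mathrm{id},1],\quad [\beta,1],\quad s_n^{p^l},\quad \beta s_n^{p^l}\qquad (n\ge 2,\ 0\le l\le f-1)$$ form a basis over $\overline{\mathbb F}_p$ of the space $\tau^{I(1)}$ of $I(1)$-invariants of $\tau$.
   Context: Let $p$ be a prime and $F$ a finite extension of $\mathbb Q_p$ with ramification index $e$, residue degree $f$, ring of integers $\mathcal O$, uniformizer $\varpi$ and residue field $\mathbb F_q$, $q=p^f$. Fix an embedding $\mathbb F_q\hookrightarrow\overline{\mathbb F}_p$. For $x\in\mathbb F_q$, $[x]\in\mathcal O$ is its multiplicative (Teichmüller) representative. For $n\ge1$ put $I_n=\{[\mu_0]+[\mu_1]\varpi+\dots+[\mu_{n-1}]\varpi^{n-1} : \mu_i\in\mathbb F_q\}\subset\mathcal O$; for $\mu\in I_n$ the $\mu_i\in\mathbb F_q$ denote its digits. $G=\mathrm{GL}_2(F)$, $Z$ is its center, $K=\mathrm{GL}_2(\mathcal O)$, $I\subset K$ is the Iwahori subgroup of matrices upper triangular mod $\varpi$, and $I(1)\subset I$ is the pro-$p$-Iwahori subgroup of matrices upper triangular unipotent mod $\varpi$. Put $\beta=\begin{pmatrix}0&1\\ \varpi&0\end{pmatrix}$. $\mathrm{ind}_{IZ}^G\mathbf 1$ is the compact induction (over $\overline{\mathbb F}_p$)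 of the trivial character of $IZ$. For $g\in G$, $[g,1]$ is the standard element of it attached to the coset $gIZ$ (the characteristic function of that coset), so $[gk,1]=[g,1]$ for $k\in IZ$ and $h\cdot[g,1]=[hg,1]$ for $h\in G$. The $G$-equivariant operator $T_{1,2}$ on $\mathrm{ind}_{IZ}^G\mathbf 1$ is given by $$T_{1,2}[g,1]=\sum_{\lambda\in I_1}\left[g\begin{pmatrix}1&0\\ \varpi\lambda&\varpi\end{pmatrix},1\right],$$ and $(\mathrm{Im}\,T_{1,2},\mathrm{Ker}\,T_{1,2})$ denotes the sum of the two subrepresentations. For $n\ge1$ and $0\le k\le q-1$, $$s_n^k=\sum_{\mu\in I_n}\mu_{n-1}^k\left[\begin{pmatrix}\varpi^n&\mu\\0&1\end{pmatrix},1\right]\qquad(0^0=1).$$ *)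

(* Defs.v *)
From HB Require Import structures.
From mathcomp Require Import all_boot all_order all_algebra all_field.
From mathcomp Require Import generic_quotient ring_quotient.
From mathcomp Require Import boolp functions zify ring.

Set Implicit Arguments.
Unset Strict Implicit.
Unset Printing Implicit Defensive.

Import Order.TTheory GRing.Theory Num.Theory.
Local Open Scope ring_scope.
Local Open Scope quotient_scope.

(* Discrete valuations. The value at 0 is unconstrained and is never used:    *)
(* [vge w n] reads "w x >= n" under the convention w 0 = +oo.                 *)
Record valuation (K : fieldType) := Valuation {
  valuation_fun :> K -> int;
  valuationM : forall x y, x != 0 -> y != 0 ->
    valuation_fun (x * y) = valuation_fun x + valuation_fun y;
  valuationD : forall x y, x != 0 -> y != 0 -> x + y != 0 ->
    Num.min (valuation_fun x) (valuation_fun y) <= valuation_fun (x + y)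
}.

Section Valuation.
Variables (K : fieldType) (w : valuation K).

Definition vge (n : int) : pred K := [pred x | (x == 0) || (n <= w x)].

Lemma valuation1 : w 1 = 0.
Proof.
by apply: (@addrI _ (w 1)); rewrite addr0 -valuationM ?oner_neq0// mulr1.
Qed.

Lemma valuationN1 : w (-1) = 0.
Proof.
have N10 : (-1 : K) != 0 by rewrite oppr_eq0 oner_neq0.
by have := valuationM w N10 N10; rewrite mulrNN mulr1 valuation1; lia.
Qed.

Lemma valuationN x : x != 0 -> w (- x) = w x.
Proof.
by move=> x0; rewrite -mulN1r valuationM ?oppr_eq0 ?oner_neq0// valuationN1 add0r.
Qed.

Lemma vge0 n : vge n 0. Proof. by rewrite /vge /= eqxx. Qed.

Lemma vgeD n x y : vge n x -> vge n y -> vge n (x + y).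
Proof.
rewrite /vge /=; have [->|x0] := eqVneq x 0; first by rewrite add0r.
have [->|y0] := eqVneq y 0; first by rewrite addr0 (negPf x0).
have [//|xy0] /= := eqVneq (x + y) 0.
move=> nx ny; have := valuationD w x0 y0 xy0.
by rewrite ge_min; case/orP; apply: le_trans.
Qed.

Lemma vgeN n x : vge n x -> vge n (- x).
Proof.
rewrite /vge /= oppr_eq0; have [//|x0] /= := eqVneq x 0.
by rewrite valuationN.
Qed.

Lemma vgeM m n x y : vge m x -> vge n y -> vge (m + n) (x * y).
Proof.
rewrite /vge /= mulf_eq0; have [//|x0] /= := eqVneq x 0.
have [//|y0] /= := eqVneq y 0.
by rewrite valuationM//; exact: lerD.
Qed.

Definition Oint : pred K := vge 0.

Lemma Oint_subring : subring_closed Oint.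
Proof.
split; first by rewrite inE /Oint /vge /= valuation1 lexx orbT.
  by move=> x y Ox Oy; apply: vgeD => //; apply: vgeN.
by move=> x y Ox Oy; have := vgeM Ox Oy; rewrite addr0.
Qed.

HB.instance Definition _ := GRing.isSubringClosed.Build K Oint Oint_subring.

Record integers := Integers {
  integers_val :> K;
  integersP : integers_val \in Oint
}.
HB.instance Definition _ := [isSub for integers_val].
HB.instance Definition _ := [Choice of integers by <:].
HB.instance Definition _ := [SubChoice_isSubComNzRing of integers by <:].

Lemma OintM x y : x \in Oint -> y \in Oint -> x * y \in Oint.
Proof. exact: rpredM. Qed.

End Valuation.

(* (Qp, vp) is Q_p: the completion of Q for the p-adic valuation.             *)
Definition rat_val (p : nat) (r : rat) : int :=
  (logn p `|numq r|%N)%:Z - (logn p `|denq r|%N)%:Z.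

Record is_Qp (p : nat) (Qp : fieldType) (vp : valuation Qp) : Prop := IsQp {
  Qp_char0 : [pchar Qp] =i pred0;
  Qp_rat : forall r : rat, r != 0 -> vp (ratr r) = rat_val p r;
  Qp_dense : forall (x : Qp) (N : nat), exists r : rat, vge vp N (x - ratr r);
  Qp_complete : forall u : nat -> Qp,
    (forall N : nat, exists M : nat, forall i j : nat,
       (M <= i)%N -> (M <= j)%N -> vge vp N (u i - u j)) ->
    exists l : Qp, forall N : nat, exists M : nat, forall i : nat,
      (M <= i)%N -> vge vp N (u i - l)
}.

Section LocalField.
Variables (Qp : fieldType) (vp : valuation Qp).
Variables (F : fieldExtType Qp) (v : valuation F).

Definition is_uniformizer (varpi : F) : Prop := varpi != 0 /\ v varpi = 1.

(* With v normalized by the existence of a uniformizer, this equation says    *)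
(* that v is the (unique) valuation of F extending that of Q_p and that        *)
(* e is the index of v(Q_p^* ) in v(F^* ).                                    *)
Definition has_ramification_index (e : nat) : Prop :=
  forall x : Qp, x != 0 -> v (x%:A) = e%:Z * vp x.

Variable Fq : finFieldType.

Definition is_residue_map (res : {rmorphism integers v -> Fq}) : Prop :=
  (forall y, exists x, res x = y) /\
  (forall x, res x = 0 <-> vge v 1 (val x)).

(* The Teichmüller lift is the unique multiplicative section of the reduction. *)
Definition is_teichmuller (res : {rmorphism integers v -> Fq})
    (teich : Fq -> integers v) : Prop :=
  cancel teich res /\ {morph teich : x y / x * y}.

End LocalField.

Section GL2.
Variable F : fieldType.

Record GL2 := MkGL2 { GL2_val :> 'M[F]_2; GL2P : GL2_val \in unitmx }.
HB.instance Definition _ := [isSub for GL2_val].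
HB.instance Definition _ := [Choice of GL2 by <:].

Fact GL2_one_proof : (1%:M : 'M[F]_2) \in unitmx. Proof. exact: unitmx1. Qed.
Fact GL2_mul_proof (g h : GL2) : GL2_val g *m GL2_val h \in unitmx.
Proof. by rewrite unitmx_mul !GL2P. Qed.
Fact GL2_inv_proof (g : GL2) : invmx (GL2_val g) \in unitmx.
Proof. by rewrite unitmx_inv GL2P. Qed.

Definition GL2_one := MkGL2 GL2_one_proof.
Definition GL2_mul g h := MkGL2 (GL2_mul_proof g h).
Definition GL2_inv g := MkGL2 (GL2_inv_proof g).

Fact GL2_mulA : associative GL2_mul.
Proof. by move=> x y z; apply: val_inj; exact: mulmxA. Qed.
Fact GL2_mul1 : left_id GL2_one GL2_mul.
Proof. by move=> x; apply: val_inj; exact: mul1mx. Qed.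
Fact GL2_1mul : right_id GL2_one GL2_mul.
Proof. by move=> x; apply: val_inj; exact: mulmx1. Qed.
Fact GL2_mulV : left_inverse GL2_one GL2_inv GL2_mul.
Proof. by move=> x; apply: val_inj; apply: mulVmx; exact: GL2P. Qed.
Fact GL2_Vmul : right_inverse GL2_one GL2_inv GL2_mul.
Proof. by move=> x; apply: val_inj; apply: mulmxV; exact: GL2P. Qed.

HB.instance Definition _ :=
  isGroup.Build GL2 GL2_mulA GL2_mul1 GL2_1mul GL2_mulV GL2_Vmul.

(* The matrix (a b; c d); the junk value 1 is taken when it is singular.      *)
Definition mat2 (a b c d : F) : GL2 :=
  insubd (1%g : GL2) (\matrix_(i < 2, j < 2)
    if i == 0 then (if j == 0 then a else b) else (if j == 0 then c else d)).

End GL2.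

Section Subgroups.
Variables (F : fieldType) (v : valuation F).
Implicit Types g k z : GL2 F.

Definition GL2O : pred (GL2 F) :=
  [pred g : GL2 F | [forall i, [forall j,
     (GL2_val g i j \in Oint v) && (GL2_val (g^-1)%g i j \in Oint v)]]].

Definition iwahori : pred (GL2 F) :=
  [pred g : GL2 F | (g \in GL2O) && vge v 1 (GL2_val g 1 0)].

Definition pro_p_iwahori : pred (GL2 F) :=
  [pred g : GL2 F | [&& g \in GL2O, vge v 1 (GL2_val g 1 0),
     vge v 1 (GL2_val g 0 0 - 1) & vge v 1 (GL2_val g 1 1 - 1)]].

Definition center (G : groupType) : pred G :=
  [pred z : G | `[< forall g : G, (z * g = g * z)%g >]].

Definition iwahoriZ : pred (GL2 F) :=
  [pred g : GL2 F | `[< exists k z, [/\ k \in iwahori, z \in @center (GL2 F)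
                              & g = (k * z)%g] >]].
End Subgroups.

Section IwahoriGroup.
Variables (F : fieldType) (v : valuation F).
Implicit Types g k z : GL2 F.

Lemma GL2OP g :
  reflect (forall i j, GL2_val g i j \in Oint v /\ GL2_val (g^-1)%g i j \in Oint v)
          (g \in GL2O v).
Proof.
apply: (iffP forallP) => [h i j|h i]; first by have /forallP/(_ j)/andP := h i.
by apply/forallP => j; apply/andP; exact: h.
Qed.

Lemma GL2_mulE g h i j :
  GL2_val (g * h)%g i j = GL2_val g i 0 * GL2_val h 0 j + GL2_val g i 1 * GL2_val h 1 j.
Proof.
rewrite -[GL2_val (g * h)%g]/(GL2_val g *m GL2_val h) mxE big_ord_recl big_ord1.
by rewrite (_ : lift ord0 ord0 = 1)//; exact: val_inj.
Qed.

Lemma GL2_1E i j : GL2_val (1%g : GL2 F) i j = (i == j)%:R.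
Proof. by rewrite -[GL2_val 1%g]/(1%:M : 'M_2) mxE. Qed.

Lemma vge1M x y : x \in Oint v -> vge v 1 y -> vge v 1 (x * y).
Proof. by move=> Ox my; have := vgeM Ox my; rewrite add0r. Qed.

Lemma iwahori1 : (1%g : GL2 F) \in iwahori v.
Proof.
rewrite inE; apply/andP; split; last by rewrite GL2_1E vge0.
have O1 i j : GL2_val 1%g i j \in Oint v.
  by rewrite GL2_1E; case: (i == j); rewrite ?rpred0 ?rpred1.
by apply/GL2OP => i j; rewrite invg1.
Qed.

Lemma iwahoriM : {in iwahori v &, forall g h, (g * h)%g \in iwahori v}.
Proof.
move=> g h /andP[/GL2OP Og mg] /andP[/GL2OP Oh mh].
apply/andP; split; last first.
  rewrite GL2_mulE; apply: vgeD; last by apply: vge1M => //; case: (Og 1 1).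
  by rewrite mulrC; apply: vge1M => //; case: (Oh 0 0).
apply/GL2OP => i j; rewrite invgM !GL2_mulE; split; apply: rpredD;
  apply: OintM; by [case: (Og i 0)|case: (Og i 1)|case: (Oh 0 j)|case: (Oh 1 j)
                   |case: (Og 0 j)|case: (Og 1 j)|case: (Oh i 0)|case: (Oh i 1)].
Qed.

Lemma iwahoriV : {in iwahori v, forall g, (g^-1)%g \in iwahori v}.
Proof.
move=> g /andP[/GL2OP Og mg]; apply/andP; split.
  by apply/GL2OP => i j; rewrite invgK; case: (Og i j).
have E i j : GL2_val (g * g^-1)%g i j = (i == j)%:R by rewrite mulgV GL2_1E.
have := E 1 0; have := E 1 1; rewrite !GL2_mulE /=.
set c := GL2_val g 1 0; set d := GL2_val g 1 1; set h := GL2_val (g^-1)%g.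
move=> E11 E10.
have -> : h 1 0 = h 1 0 * h 0 1 * c - h 1 1 * h 0 0 * c.
  transitivity (h 1 0 * (c * h 0 1 + d * h 1 1) - h 1 1 * (c * h 0 0 + d * h 1 0)).
    by rewrite E11 E10 mulr1 mulr0 subr0.
  by ring.
have Oh i j : h i j \in Oint v by case: (Og i j).
by apply: vgeD; [|apply: vgeN]; apply: vge1M => //; exact: OintM.
Qed.

Lemma iwahoriZP g :
  reflect (exists k z, [/\ k \in iwahori v, z \in @center (GL2 F)
                         & g = (k * z)%g]) (g \in iwahoriZ v).
Proof. exact: asboolP. Qed.

Lemma iwahoriZ1 : (1%g : GL2 F) \in iwahoriZ v.
Proof.
apply/iwahoriZP; exists 1%g, 1%g; split; rewrite ?mulg1 ?iwahori1//.
by apply/asboolP => h; rewrite mul1g mulg1.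
Qed.

Lemma iwahoriZM : mulg_closed (iwahoriZ v).
Proof.
move=> _ _ /iwahoriZP[k [z [kI /asboolP zZ ->]]]
  /iwahoriZP[k' [z' [kI' /asboolP zZ' ->]]].
apply/iwahoriZP; exists (k * k')%g, (z * z')%g; split.
- exact: iwahoriM.
- by apply/asboolP => h; rewrite -mulgA zZ' mulgA zZ mulgA.
- by rewrite -!mulgA; congr (_ * _)%g; rewrite !mulgA zZ.
Qed.

Lemma iwahoriZV : invg_closed (iwahoriZ v).
Proof.
move=> _ /iwahoriZP[k [z [kI /asboolP zZ ->]]].
apply/iwahoriZP; exists (k^-1)%g, (z^-1)%g; split.
- exact: iwahoriV.
- apply/asboolP => h; apply: (@invg_inj (GL2 F)).
  by rewrite !invgM invgK zZ.
- by rewrite -invgM zZ.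
Qed.

HB.instance Definition _ := isMulClosed.Build (GL2 F) (iwahoriZ v) iwahoriZM.
HB.instance Definition _ := isMul1Closed.Build (GL2 F) (iwahoriZ v) iwahoriZ1.
HB.instance Definition _ := isInvClosed.Build (GL2 F) (iwahoriZ v) iwahoriZV.

Definition IZ : groupClosed (GL2 F) := GroupClosed.clone (GL2 F) (iwahoriZ v) _.

End IwahoriGroup.

(* ind_H^G 1, for H open in G: functions on G right invariant under H and     *)
(* supported on finitely many cosets gH, with G acting by left translation.   *)
(* Smoothness is automatic.                                                   *)
Section Induction.
Variables (G : groupType) (H : groupClosed G) (C : fieldType).

Definition cind_pred : pred (G -> C^o) := [pred phi |
  `[< (forall g k, k \in H -> phi (g * k)%g = phi g) /\
      (exists s : seq G, forall g, phi g != 0 ->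
         exists2 x, x \in s & (x^-1 * g)%g \in H) >]].

Lemma cind_submod : submod_closed cind_pred.
Proof.
split.
  apply/asboolP; split=> //; exists [::] => g.
  by rewrite -[(0 : G -> C^o) g]/(0 : C) eqxx.
move=> a x y /asboolP[xH [s xs]] /asboolP[yH [t yt]]; apply/asboolP; split.
  by move=> g k kH; rewrite -![(a *: x + y) _]/(a * x _ + y _) xH// yH.
exists (s ++ t) => g; rewrite -[(a *: x + y) _]/(a * x g + y g) => nz.
have [x0|/xs[u us uH]] := eqVneq (x g) 0; last first.
  by exists u => //; rewrite mem_cat us.
have [|u ut uH] := yt g; last by exists u => //; rewrite mem_cat ut orbT.
by apply: contraNneq nz => ->; rewrite x0 mulr0 addr0.
Qed.

HB.instance Definition _ :=
  GRing.isSubmodClosed.Build C (G -> C^o) cind_pred cind_submod.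

Record cind := Cind { cind_val :> G -> C^o; cindP : cind_val \in cind_pred }.
HB.instance Definition _ := [isSub for cind_val].
HB.instance Definition _ := [Choice of cind by <:].
HB.instance Definition _ := [SubChoice_isSubLmodule of cind by <:].

Fact bracket_proof (g : G) :
  (fun x : G => ((g^-1 * x)%g \in H)%:R : C^o) \in cind_pred.
Proof.
apply/asboolP; split; first by move=> x k kH; rewrite mulgA gpredMr.
exists [:: g] => x; case: (boolP ((g^-1 * x)%g \in H)) => [gx _|_].
  by exists g; rewrite ?inE.
by rewrite eqxx.
Qed.

Definition bracket (g : G) : cind := Cind (bracket_proof g).

Fact act_proof (h : G) (phi : cind) :
  (fun x : G => phi (h^-1 * x)%g : C^o) \in cind_pred.
Proof.
have /asboolP[inv [s supp]] := cindP phi; apply/asboolP; split.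
  by move=> x k kH; rewrite mulgA inv.
exists [seq (h * x)%g | x <- s] => x /supp[u us uH].
by exists (h * u)%g; [exact: map_f | rewrite invgM -mulgA].
Qed.

Definition act (h : G) (phi : cind) : cind := Cind (act_proof h phi).

Lemma act_bracket h g : act h (bracket g) = bracket (h * g)%g.
Proof.
by apply: val_inj; apply/funext => x /=; rewrite invgM mulgA.
Qed.

End Induction.

Section QuotientByImKer.
Variables (K : fieldType) (V : lmodType K) (T : {linear V -> V}).

Definition im_add_ker : pred V :=
  [pred x : V | `[< exists y z : V, T z = 0 /\ x = T y + z >]].

Lemma im_add_ker_submod : submod_closed im_add_ker.
Proof.
split; first by apply/asboolP; exists 0, 0; rewrite !linear0 addr0.
move=> a _ _ /asboolP[y [z [Tz ->]]] /asboolP[y' [z' [Tz' ->]]].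
apply/asboolP; exists (a *: y + y'), (a *: z + z'); split.
  by rewrite linearP Tz Tz' scaler0 addr0.
by rewrite linearP scalerDr addrACA.
Qed.

Lemma im_add_ker_zmod : zmod_closed im_add_ker.
Proof. exact: GRing.submod_closedB im_add_ker_submod. Qed.

HB.instance Definition _ := GRing.isZmodClosed.Build V im_add_ker im_add_ker_zmod.

Lemma im_add_kerZ a x : x \in im_add_ker -> a *: x \in im_add_ker.
Proof.
have [W0 WP] := im_add_ker_submod.
by move=> xW; rewrite -[a *: x]addr0; exact: WP.
Qed.

Let W : zmodClosed V := GRing.ZmodClosed.clone V im_add_ker _.

Definition quot_im_ker : Type := Quotient.quot W.
HB.instance Definition _ := GRing.Zmodule.on quot_im_ker.
HB.instance Definition _ := EqQuotient.on quot_im_ker.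

Definition qpi : V -> quot_im_ker := \pi_(Quotient.quot W).

Lemma qpi_eq x y : qpi x = qpi y <-> x - y \in im_add_ker.
Proof. by rewrite Quotient.idealrBE; split=> [/eqP|/eqP]. Qed.

Lemma qpi_repr (x : quot_im_ker) : qpi (repr x) = x.
Proof. exact: reprK. Qed.

Lemma qpiD x y : qpi (x + y) = qpi x + qpi y.
Proof. exact: (raddfD (\pi_(Quotient.quot W))). Qed.

Definition qscale (a : K) (x : quot_im_ker) : quot_im_ker := qpi (a *: repr x).

Lemma qpiZ a x : qpi (a *: x) = qscale a (qpi x).
Proof.
apply/qpi_eq; rewrite -scalerBr; apply: im_add_kerZ; apply/qpi_eq.
by rewrite qpi_repr.
Qed.

Fact qscaleA a b x : qscale a (qscale b x) = qscale (a * b) x.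
Proof. by rewrite -[x]qpi_repr -!qpiZ scalerA. Qed.
Fact qscale1 : left_id 1 qscale.
Proof. by move=> x; rewrite -[x]qpi_repr -qpiZ scale1r. Qed.
Fact qscaleDr : right_distributive qscale +%R.
Proof.
by move=> a x y; rewrite -[x]qpi_repr -[y]qpi_repr -qpiD -!qpiZ scalerDr qpiD.
Qed.
Fact qscaleDl x : {morph qscale^~ x : a b / a + b}.
Proof. by move=> a b; rewrite -[x]qpi_repr -!qpiZ scalerDl qpiD. Qed.

HB.instance Definition _ := GRing.Zmodule_isLmodule.Build K quot_im_ker
  qscaleA qscale1 qscaleDr qscaleDl.

End QuotientByImKer.

Section Basis.
Variables (K : fieldType) (V : lmodType K) (J : eqType).

Definition is_basis (S : V -> Prop) (b : J -> V) : Prop :=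
  [/\ forall j, S (b j),
      forall (r : seq J) (c : J -> K), uniq r ->
        \sum_(j <- r) c j *: b j = 0 -> forall j, j \in r -> c j = 0
    & forall x, S x ->
        exists (r : seq J) (c : J -> K), x = \sum_(j <- r) c j *: b j].

End Basis.

Section Tau.
Variables (F : fieldType) (v : valuation F) (C : fieldType).

Definition ind := cind (IZ v) C.
HB.instance Definition _ := GRing.Lmodule.on ind.

Definition br (g : GL2 F) : ind := bracket (IZ v) C g.

Variables (varpi : F) (Fq : finFieldType) (teich : Fq -> integers v).

Definition beta : GL2 F := mat2 0 1 varpi 0.

(* This determines T, as the [g, 1] span the induced representation. *)
Definition is_T12 (T : {linear ind -> ind}) : Prop :=
  forall g : GL2 F, T (br g) =
    \sum_(x : Fq) br (g * mat2 1 0 (varpi * val (teich x)) varpi)%g.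

Definition teich_expansion (n : nat) (mu : n.-tuple Fq) : F :=
  \sum_(i < n) val (teich (tnth mu i)) * varpi ^+ i.

(* I_n is indexed by the tuples of digits (mu_0, ..., mu_(n-1)). *)
Definition s (iota : Fq -> C) (n k : nat) : ind :=
  \sum_(mu : n.-tuple Fq) iota (nth 0 mu n.-1) ^+ k *:
    br (mat2 (varpi ^+ n) (teich_expansion mu) 0 1).

Variable T : {linear ind -> ind}.

Definition tau := quot_im_ker T.
HB.instance Definition _ := GRing.Lmodule.on tau.

(* Action of G on tau; independent of the representative since Im T + Ker T   *)
(* is G-stable.                                                               *)
Definition tau_act (h : GL2 F) (x : tau) : tau := qpi T (act h (repr x)).

Definition tau_invariants (U : pred (GL2 F)) (x : tau) : Prop :=
  forall h, h \in U -> tau_act h x = x.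

(* [id, 1], [beta, 1], s_n^(p^l) and beta s_n^(p^l), the pair (m, l) standing *)
(* for n = m + 2.                                                             *)
Definition tau_family (iota : Fq -> C) (p f : nat)
    (j : bool + bool * (nat * 'I_f)) : tau :=
  qpi T match j with
        | inl false => br 1%g
        | inl true => br beta
        | inr (false, (m, l)) => s iota m.+2 (p ^ l)
        | inr (true, (m, l)) => act beta (s iota m.+2 (p ^ l))
        end.

End Tau.

(* Main.v *)
Require Import Defs.
From HB Require Import structures.
From mathcomp Require Import all_boot all_order all_algebra all_field.
From mathcomp Require Import boolp zify ring.

Set Implicit Arguments.
Unset Strict Implicit.
Unset Printing Implicit Defensive.

Import Order.TTheory GRing.Theory Num.Theory.
Local Open Scope ring_scope.

(** Write [q] for the size of the residue field.  The cosets of [IZ] are the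
    oriented edges of the Bruhat-Tits tree: the identity is the edge from the
    base vertex [x0] to [x1 = beta x0], and [beta] reverses it.  On edges, [T12]
    is the non-backtracking operator, sending [x -> y] to the sum of the edges
    [y -> z] with [z != x].  As [q] vanishes in the coefficients, its image
    consists of the functions whose sum over the edges leaving any given vertex
    is zero, and its kernel of the functions that depend only on the target of
    an edge.  Hence [tau] is the space of finitely supported functions on
    vertices modulo, for every vertex, the sum of its neighbours.  These
    relations hold by [e_KZ] and [e_in_edges], and there are no others by
    [qpi_eq0_adjacency] and [vertex_sum_eq0].

    Removing the edge [x0 - x1] cuts the tree into two halves exchanged by
    [beta].  The vertices at depth [n] of a half are the words of [n] digits
    ([vertex_cover], [vertex_inj]), and the pro-p Iwahori subgroup preserves
    depths and halves.  The relation at a vertex equates the sum of its children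
    with minus its parent, so a function at depth [n] that does not depend on
    the last digit moves to depth [n - 2] ([reduce_depth]).

    Consider an invariant class and the outermost layer of a representative.
    A group element changes this layer by a function of the previous digits.
    Applied to translations, this says that the layer is the sum of such a
    function and of an additive function of the last digit
    ([last_digit_partP], [last_digit_part_add]), that is, of a combination of
    the [t ^ (p ^ l)] ([additive_fun_Frobenius]).  So subtracting multiples of the
    [s_n^(p^l)] decreases the depth by one.  At depth one the additive part
    vanishes, since translating it would produce a multiple of the root of the
    other half ([last_digit_part0]).

    Conversely [s_n^(p^l)] is invariant for [n >= 2] ([s_inv]).  A group element
    adds to the last digit a function [H] of the previous ones, so it changes
    [s_n^(p^l)] by a function of these; moved to depth [n - 2], this change
    becomes the sum of [H ^ (p ^ l)] over the last digit but one.  That sum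
    vanishes by [sum_digit_moebius], where [e * f > 1] disposes of the carries in the
    addition of Teichmueller digits and [q > 3] of the quadratic term of a
    Moebius transformation.

    For linear independence, all functions in the family vanish on words of
    positive length ending in the digit zero.  If a combination of them gives the
    sums over neighbours of a finitely supported function, this forces that
    function to vanish ([adjacency_inj]), so the combination is itself zero.
    What remains is the independence of the Frobenius powers
    ([Frobenius_free]). *)

(** * Additive maps on a finite field *)

(** Multiplication by an element [a] with [a ^ k != 1] permutes the summands and
    multiplies the sum by [a ^ k]. *)
Lemma sum_expr_finField (L : finFieldType) k :
  (0 < k)%N -> (k.+1 < #|L|)%N -> \sum_(t : L) t ^+ k = 0.
Proof.
move=> k_gt0 kq; have [a a0 ak] : exists2 a : L, a != 0 & a ^+ k != 1.
  apply/exists_inP; apply: contraTT kq => /exists_inPn ak.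
  have /max_poly_roots R : ('X^k - 1 : {poly L}) != 0.
    by rewrite -size_poly_gt0 size_XnsubC.
  have /R : all (root ('X^k - 1)) (enum (predC1 (0 : L))).
    apply/allP => a; rewrite mem_enum => /ak; rewrite negbK => /eqP {}ak.
    by rewrite rootE !hornerE ak subrr.
  rewrite enum_uniq => /(_ isT); rewrite size_XnsubC// -cardE cardC1 ltnS -leqNgt.
  by case: #|L|.
apply/eqP; have /eqP : \sum_(t : L) t ^+ k = a ^+ k * \sum_(t : L) t ^+ k.
  rewrite {1}(reindex_inj (mulfI a0)) mulr_sumr.
  by apply: eq_bigr => t _; rewrite exprMn.
by rewrite -subr_eq0 -{1}[\sum_t _]mul1r -mulrBl mulf_eq0 subr_eq0 eq_sym (negPf ak).
Qed.

Section AdditiveMaps.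
Variables (Fq : finFieldType) (C : fieldType) (iota : {rmorphism Fq -> C}).
Variables (p f : nat).
Hypotheses (p_prime : prime p) (card_Fq : #|Fq| = (p ^ f)%N).

Lemma pchar_Fq : p \in [pchar Fq].
Proof. exact: card_finPcharP card_Fq p_prime. Qed.

Lemma pchar_C : p \in [pchar C].
Proof. by rewrite (fmorph_pchar iota) pchar_Fq. Qed.

Lemma Frobenius_additive (R : comNzRingType) (chR : p \in [pchar R]) l :
  {morph (fun x : R => x ^+ (p ^ l)) : x y / x + y}.
Proof. by move=> x y; apply: exprDn_pchar; rewrite pnatX pnatE// chR. Qed.

Lemma poly_eq0_on_Fq (P : {poly C}) :
  (size P <= #|Fq|)%N -> (forall t, P.[iota t] = 0) -> P = 0.
Proof.
move=> szP P0; apply/eqP; apply: contraTT szP => /max_poly_roots R.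
rewrite -ltnNge cardE -(size_map iota); apply: R.
  by apply/allP => _ /mapP[t _ ->]; rewrite rootE P0.
by rewrite map_inj_uniq ?enum_uniq//; exact: fmorph_inj.
Qed.

(** Lagrange interpolation, with [1 - ('X - s) ^ (q - 1)] as indicator of [s]. *)
Lemma poly_of_fun (alpha : Fq -> C) : exists2 P : {poly C},
  (size P <= #|Fq|)%N & forall t, P.[iota t] = alpha t.
Proof.
pose P := \sum_(s : Fq) alpha s *: (1 - ('X - (iota s)%:P) ^+ #|Fq|.-1).
have q1 := finNzRing_gt1 Fq; exists P.
  apply: leq_trans (size_sum _ _ _) _; apply/bigmax_leqP => s _.
  apply: leq_trans (size_scale_leq _ _) _.
  apply: leq_trans (size_polyD _ _) _; rewrite size_polyN size_poly1 geq_max.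
  by rewrite (ltnW q1) size_exp_XsubC ltn_predL (ltnW q1).
move=> t; rewrite horner_sum (bigD1 t)//= big1 => [|s st].
  rewrite addr0 !hornerE subrr expr0n; case: (#|Fq|) q1 => [|[|n]] //= _.
  by rewrite subr0 mulr1.
rewrite !hornerE -rmorphB -rmorphXn /=.
have ts0 : t - s != 0 by rewrite subr_eq0 eq_sym.
suff -> : (t - s) ^+ #|Fq|.-1 = 1 by rewrite rmorph1 subrr mulr0.
by apply: (mulfI ts0); rewrite mulr1 -exprS prednK ?expf_card// (ltnW q1).
Qed.

(** If [P] is additive on [Fq], its derivative is invariant under translation by
    [Fq], hence constant by its degree.  So, up to a linear term, [P] is a
    polynomial in ['X^p], which is again additive because the Frobenius map of
    [Fq] is bijective. *)
Lemma additive_poly m (P : {poly C}) :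
  (size P <= p ^ m)%N -> (m <= f)%N ->
  (forall s t, P.[iota (s + t)] = P.[iota s] + P.[iota t]) ->
  exists a : nat -> C, forall t, P.[iota t] = \sum_(l < m) a l * iota t ^+ (p ^ l).
Proof.
elim: m P => [|m IHm] P szP mf addP.
  exists (fun=> 0) => t; rewrite big_ord0; have := addP 0 0.
  rewrite addr0 (size1_polyC szP) !hornerC => /eqP.
  by rewrite -subr_eq0 opprD addrA subrr sub0r oppr_eq0 => /eqP.
have p_gt0 := prime_gt0 p_prime; have szPq : (size P <= #|Fq|)%N.
  by rewrite card_Fq (leq_trans szP)// leq_pexp2l.
have dP t : P^`().[iota t] = P^`().[0].
  have /(congr1 (fun Q => Q^`().[0])) : P \Po ('X + (iota t)%:P) = P + P.[iota t]%:P.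
    apply/eqP; rewrite -subr_eq0; apply/eqP/poly_eq0_on_Fq => [|s].
      have q1 := finNzRing_gt1 Fq.
      apply: leq_trans (size_polyD _ _) _; rewrite geq_max size_polyN.
      rewrite size_comp_poly2 ?size_XaddC// szPq.
      apply: leq_trans (size_polyD _ _) _; rewrite geq_max szPq.
      by apply: leq_trans (size_polyC_leq1 _) (ltnW q1).
    by rewrite !(hornerE, horner_comp) -rmorphD addP subrr.
  by rewrite deriv_comp !(derivE, hornerE, horner_comp).
set d := P^`().[0] in dP; have {}dP : P^`() = d%:P.
  apply/eqP; rewrite -subr_eq0; apply/eqP/poly_eq0_on_Fq => [|t]; last first.
    by rewrite !hornerE dP subrr.
  apply: leq_trans (size_polyD _ _) _; rewrite geq_max size_polyN.
  rewrite (leq_trans (size_polyC_leq1 _) (ltnW (finNzRing_gt1 Fq))) andbT.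
  apply: leq_trans szPq; have [->|P0] := eqVneq P 0; first by rewrite deriv0 size_poly0.
  exact/ltnW/lt_size_deriv.
pose R := \poly_(i < p ^ m) P`_(p * i).
have P_eq : P = d *: 'X + (R \Po 'X^p).
  apply/polyP => k; rewrite coefD coefZ coefX coef_comp_poly_Xn// coef_poly.
  have [/dvdnP[i ->]|pk] := boolP (p %| k)%N.
    rewrite mulnK// (_ : (i * p == 1)%N = false) ?mulr0 ?add0r; last first.
      by apply/negP => /eqP/(congr1 (dvdn p)); rewrite dvdn_mull// dvdn1;
        case: p p_prime => [|[]].
    case: ltnP => [_|mi]; first by rewrite mulnC.
    apply: nth_default; apply: leq_trans szP _.
    by rewrite expnSr leq_mul2r mi orbT.
  rewrite addr0; case: k pk => [|k pk]; first by rewrite dvdn0.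
  have := congr1 (fun Q : {poly C} => Q`_k) dP.
  rewrite coef_deriv coefC eqSS; case: k pk => [|k] pk /= E.
    by rewrite -E mulr1.
  rewrite mulr0; apply/eqP; have /eqP := E; rewrite -mulr_natr mulf_eq0.
  by rewrite -(dvdn_pcharf pchar_C) (negPf pk) orbF.
have [|a aP] := IHm R (size_poly _ _) (ltnW mf).
  have frob_inj : injective (fun x : Fq => x ^+ p).
    by move=> x y E; apply: (fmorph_inj (pFrobenius_aut pchar_Fq)).
  have [g _ gK] := injF_bij frob_inj.
  move=> s t; rewrite -[s]gK -[t]gK.
  have E u : R.[iota (u ^+ p)] = P.[iota u] - d * iota u.
    rewrite P_eq; rewrite !(hornerE, horner_comp) rmorphXn /=.
    by rewrite addrAC subrr add0r.
  rewrite -(_ : (g s + g t) ^+ p = g s ^+ p + g t ^+ p); last first.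
    by have := Frobenius_additive pchar_Fq 1; rewrite expn1; apply.
  by rewrite !E addP rmorphD; ring.
exists (fun l => if l is l'.+1 then a l' else d) => t.
rewrite big_ord_recl /= expn0 expr1 P_eq !(hornerE, horner_comp).
congr (_ + _); rewrite -rmorphXn aP; apply: eq_bigr => l _.
by rewrite rmorphXn -exprM -expnS.
Qed.

Lemma additive_fun_Frobenius (alpha : Fq -> C) :
  {morph alpha : s t / s + t} ->
  exists a : 'I_f -> C, forall t, alpha t = \sum_(l < f) a l * iota t ^+ (p ^ l).
Proof.
move=> addA; have [P szP PE] := poly_of_fun alpha.
have [||a aP] := @additive_poly f P _ (leqnn f); first by rewrite -card_Fq.
  by move=> s t; rewrite !PE addA.
by exists (fun l => a l) => t; rewrite -PE aP.
Qed.

Lemma Frobenius_free (a : 'I_f -> C) :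
  (forall t, \sum_(l < f) a l * iota t ^+ (p ^ l) = 0) -> forall l, a l = 0.
Proof.
move=> a0 l; pose P := \sum_(l < f) a l *: 'X^(p ^ l).
have P0 : P = 0.
  apply: poly_eq0_on_Fq => [|t].
    apply: leq_trans (size_sum _ _ _) _; apply/bigmax_leqP => i _.
    apply: leq_trans (size_scale_leq _ _) _.
    by rewrite size_polyXn card_Fq ltn_exp2l ?prime_gt1.
  by rewrite -(a0 t) horner_sum; apply: eq_bigr => i _; rewrite hornerZ hornerXn.
have := congr1 (fun Q : {poly C} => Q`_(p ^ l)) P0.
rewrite coef0 coef_sum (bigD1 l)//= big1 => [|i il].
  by rewrite coefZ coefXn eqxx mulr1 addr0.
rewrite coefZ coefXn eqn_exp2l ?prime_gt1// (_ : (l == i :> nat) = false) ?mulr0//.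
by apply/negbTE; rewrite eq_sym.
Qed.

End AdditiveMaps.

(** * Valuations *)

Section ValuationTheory.
Variables (F : fieldType) (v : valuation F).

Lemma vgeW m n x : m <= n -> vge v n x -> vge v m x.
Proof. by move=> mn /orP[x0|nx]; apply/orP; [left | right; exact: le_trans nx]. Qed.

Lemma vgeB n x y : vge v n x -> vge v n y -> vge v n (x - y).
Proof. by move=> nx ny; apply: vgeD => //; apply: vgeN. Qed.

Lemma vge0M x y : vge v 0 x -> vge v 0 y -> vge v 0 (x * y).
Proof. exact: OintM. Qed.

Lemma vge01M x y : vge v 0 x -> vge v 1 y -> vge v 1 (x * y).
Proof. exact: vge1M. Qed.

Lemma vge10M x y : vge v 1 x -> vge v 0 y -> vge v 1 (x * y).
Proof. by rewrite mulrC => x1 y0; apply: vge01M. Qed.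

Lemma vge0_1 : vge v 0 1.
Proof. by rewrite /vge /= valuation1 lexx orbT. Qed.

Lemma vge_sum n (I : Type) (r : seq I) (E : I -> F) :
  (forall i, vge v n (E i)) -> vge v n (\sum_(i <- r) E i).
Proof. by move=> nE; elim/big_ind: _ => //; [exact: vge0 | exact: vgeD]. Qed.

Lemma vge0X x n : vge v 0 x -> vge v 0 (x ^+ n).
Proof.
move=> x0; elim: n => [|n IHn]; first by rewrite expr0 vge0_1.
by rewrite exprS vge0M.
Qed.

Definition vunit : pred F := [pred u | (u != 0) && (v u == 0)].

Lemma vunit_neq0 u : vunit u -> u != 0. Proof. by case/andP. Qed.

Lemma vunit_vge u : vunit u -> vge v 0 u.
Proof. by case/andP=> _ /eqP u0; rewrite /vge /= u0 lexx orbT. Qed.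

Lemma vunitM x y : vunit x -> vunit y -> vunit (x * y).
Proof.
move=> /andP[x0 /eqP vx] /andP[y0 /eqP vy].
by rewrite /vunit /= mulf_neq0// valuationM// vx vy.
Qed.

Lemma vunit1 : vunit 1. Proof. by rewrite /vunit /= oner_neq0 valuation1 /=. Qed.

Lemma valuationV x : x != 0 -> v x^-1 = - v x.
Proof.
move=> x0; apply/eqP; rewrite -addr_eq0 -valuationM ?invr_eq0//.
by rewrite mulVf// valuation1.
Qed.

Lemma vunitV x : vunit x -> vunit x^-1.
Proof.
by move=> /andP[x0 /eqP vx]; rewrite /vunit /= invr_eq0 x0 valuationV// vx.
Qed.

Lemma vunitN x : vunit (- x) = vunit x.
Proof.
rewrite /vunit /= oppr_eq0; have [//|x0] := eqVneq x 0.
by rewrite valuationN.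
Qed.

Lemma valuationX x n : x != 0 -> v (x ^+ n) = v x * n%:Z.
Proof.
move=> x0; elim: n => [|n IHn]; first by rewrite expr0 valuation1 mulr0.
by rewrite exprS valuationM ?expf_neq0// IHn; lia.
Qed.

Lemma vunitP u : vunit u <-> [/\ u != 0, vge v 0 u & ~~ vge v 1 u].
Proof.
rewrite /vunit /vge /=; have [_|u0 /=] := eqVneq u 0; first by split=> [|[]].
by split=> [/eqP->|[_ A B]] //; apply/eqP; lia.
Qed.

Lemma vunitD x y : vunit x -> vge v 1 y -> vunit (x + y).
Proof.
move=> /vunitP[_ x0 Nx] y1; have N : ~~ vge v 1 (x + y).
  by apply: contra Nx => V; have := vgeB V y1; rewrite addrK.
apply/vunitP; split=> //; last by apply: vgeD => //; apply: vgeW y1.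
by apply: contraNneq N => ->; rewrite vge0.
Qed.

Lemma vunitB x y : vunit x -> vge v 1 y -> vunit (x - y).
Proof. by move=> x0 y1; apply: vunitD => //; apply: vgeN. Qed.

Lemma vge1_vunit u : vge v 1 (u - 1) -> vunit u.
Proof. by move/(vunitD vunit1); rewrite addrC subrK. Qed.

Lemma vge_div n x y : y != 0 -> vge v n (x / y) = vge v (n + v y) x.
Proof.
move=> y0; rewrite /vge /= mulf_eq0 invr_eq0 (negPf y0) orbF.
have [//|x0 /=] := eqVneq x 0.
by rewrite valuationM ?invr_eq0// valuationV// lerBrDr.
Qed.

End ValuationTheory.

Section OneUnits.
Variables (F : fieldType) (v : valuation F).

Definition oneunit : pred F := [pred x | vge v 1 (x - 1)].

Lemma oneunit_vunit x : oneunit x -> vunit v x. Proof. exact: vge1_vunit. Qed.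

Lemma oneunit_vge0 x : oneunit x -> vge v 0 x.
Proof. by move/oneunit_vunit/vunit_vge. Qed.

Lemma oneunit_neq0 x : oneunit x -> x != 0.
Proof. by move/oneunit_vunit/vunit_neq0. Qed.

Lemma oneunitM x y : oneunit x -> oneunit y -> oneunit (x * y).
Proof.
move=> x1 y1; rewrite /oneunit /= (_ : _ - _ = (x - 1) * y + (y - 1)); last by ring.
by apply: vgeD => //; apply: vge10M => //; exact: oneunit_vge0.
Qed.

Lemma oneunitV x : oneunit x -> oneunit x^-1.
Proof.
move=> x1; have x0 := oneunit_neq0 x1; rewrite /oneunit /=.
rewrite (_ : _ - _ = - ((x - 1) * x^-1)); last by field.
by apply/vgeN/vge10M => //; exact/vunit_vge/vunitV/oneunit_vunit.
Qed.

Lemma oneunitD x y : oneunit x -> vge v 1 y -> oneunit (x + y).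
Proof. by move=> x1 y1; rewrite /oneunit /= addrAC; exact: vgeD. Qed.

Lemma oneunitB x y : oneunit x -> vge v 1 y -> oneunit (x - y).
Proof. by move=> x1 y1; apply: oneunitD => //; exact: vgeN. Qed.

End OneUnits.

(** * Two-by-two matrices and the Iwahori subgroup *)

Section TwoByTwo.
Variable F : fieldType.
Implicit Types g h : GL2 F.

Lemma GL2_eq g h : g 0 0 = h 0 0 -> g 0 1 = h 0 1 -> g 1 0 = h 1 0 ->
  g 1 1 = h 1 1 -> g = h.
Proof.
move=> e00 e01 e10 e11; apply/val_inj/matrixP => i j.
have ord2 (k : 'I_2) : k = 0 \/ k = 1.
  by case: k => [[|[|]]] // H; [left | right]; exact: val_inj.
by case: (ord2 i) (ord2 j) => -> [] ->.
Qed.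

Lemma det2 (A : 'M[F]_2) : \det A = A 0 0 * A 1 1 - A 0 1 * A 1 0.
Proof.
rewrite (expand_det_row _ 0) !big_ord_recl big_ord0 addr0 /cofactor !det_mx11 !mxE.
rewrite expr0 expr1 mul1r mulN1r mulrN.
by do ![congr (_ - _) | congr (_ * _) | congr (A _ _) | exact: val_inj].
Qed.

Lemma mat2E (a b c d : F) : a * d - b * c != 0 -> forall i j : 'I_2,
  mat2 a b c d i j =
  if i == 0 then (if j == 0 then a else b) else (if j == 0 then c else d).
Proof.
move=> D i j; rewrite /mat2 /insubd insubT /=; last by rewrite mxE.
by rewrite unitmxE det2 !mxE /= unitfE.
Qed.

Lemma GL2_det g : g 0 0 * g 1 1 - g 0 1 * g 1 0 != 0.
Proof. by have := GL2P g; rewrite unitmxE det2 unitfE. Qed.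

Lemma mat2_eta g : g = mat2 (g 0 0) (g 0 1) (g 1 0) (g 1 1).
Proof. by apply: GL2_eq; rewrite mat2E ?GL2_det. Qed.

Lemma mat2_inj (a b c d a' b' c' d' : F) : a * d - b * c != 0 ->
  a' * d' - b' * c' != 0 -> mat2 a b c d = mat2 a' b' c' d' ->
  [/\ a = a', b = b', c = c' & d = d'].
Proof.
move=> D D' E; have H i j : mat2 a b c d i j = mat2 a' b' c' d' i j by rewrite E.
by move: (H 0 0) (H 0 1) (H 1 0) (H 1 1); rewrite !mat2E.
Qed.

Lemma mat2M (a b c d a' b' c' d' : F) :
  a * d - b * c != 0 -> a' * d' - b' * c' != 0 ->
  (mat2 a b c d * mat2 a' b' c' d')%g =
  mat2 (a * a' + b * c') (a * b' + b * d') (c * a' + d * c') (c * b' + d * d').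
Proof.
move=> D D'; have DD' : (a * a' + b * c') * (c * b' + d * d') -
    (a * b' + b * d') * (c * a' + d * c') != 0.
  have -> : (a * a' + b * c') * (c * b' + d * d') -
    (a * b' + b * d') * (c * a' + d * c') = (a * d - b * c) * (a' * d' - b' * c').
    by ring.
  by rewrite mulf_neq0.
by apply: GL2_eq; rewrite GL2_mulE !mat2E.
Qed.

Lemma mat2_1 : mat2 1 0 0 1 = 1%g :> GL2 F.
Proof.
have D : (1 : F) * 1 - 0 * 0 != 0 by rewrite mulr0 subr0 mulr1 oner_neq0.
by apply: GL2_eq; rewrite GL2_1E mat2E.
Qed.

Lemma centerP g : g \in @center (GL2 F) <->
  exists2 z, z != 0 & g = mat2 z 0 0 z.
Proof.
split=> [/asboolP cg|[z z0 ->]]; last first.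
  have Z : z * z - 0 * 0 != 0 by rewrite mulr0 subr0 mulf_neq0.
  by apply/asboolP => h; rewrite [h]mat2_eta !mat2M ?GL2_det//; congr mat2; ring.
have D1 : (1 : F) * 1 - 1 * 0 != 0 by rewrite mulr0 subr0 mulr1 oner_neq0.
have D2 : (1 : F) * 1 - 0 * 1 != 0 by rewrite mul0r subr0 mulr1 oner_neq0.
have c1 i j : (g * mat2 1 1 0 1)%g i j = (mat2 1 1 0 1 * g)%g i j by rewrite cg.
have c2 i j : (g * mat2 1 0 1 1)%g i j = (mat2 1 0 1 1 * g)%g i j by rewrite cg.
move: (c1 0 0) (c1 0 1) (c2 0 0); rewrite !GL2_mulE !mat2E//=.
rewrite !(mulr1, mulr0, mul1r, mul0r, addr0) => E1 E2 E3.
have g10 : g 1 0 = 0 by apply: (addrI (g 0 0)); rewrite addr0.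
have g01 : g 0 1 = 0 by apply: (addrI (g 0 0)); rewrite addr0.
have g11 : g 1 1 = g 0 0 by apply: (addrI (g 0 1)); rewrite [RHS]addrC E2 addrC.
exists (g 0 0); last by rewrite {1}[g]mat2_eta g10 g01 g11.
by have := GL2_det g; rewrite g10 mulr0 subr0 g11; apply: contraNneq => ->; rewrite mul0r.
Qed.

End TwoByTwo.

Section IwahoriMaximal.
Variables (F : fieldType) (v : valuation F).
Implicit Types g h k : GL2 F.

Lemma vunit_det a b c d : vge v 0 b -> vge v 1 c ->
  (vge v 0 a && vge v 0 d && vunit v (a * d - b * c)) = vunit v a && vunit v d.
Proof.
move=> b0 c1; have bc1 := vge01M b0 c1.
apply/idP/idP => [/andP[/andP[a0 d0] /vunitP[_ _ N]]|/andP[ua ud]].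
  have {}N : ~~ vge v 1 (a * d) by apply: contra N => ad1; apply: vgeB.
  have na : ~~ vge v 1 a by apply: contra N => a1; rewrite mulrC vge01M.
  have nd : ~~ vge v 1 d by apply: contra N; apply: vge01M.
  apply/andP; split; apply/vunitP; split=> //.
    by apply: contraNneq na => ->; rewrite vge0.
  by apply: contraNneq nd => ->; rewrite vge0.
by rewrite (vunit_vge ua) (vunit_vge ud) (vunitB (vunitM ua ud) bc1).
Qed.

Lemma vunit_detP a b c d : vunit v a -> vunit v d -> vge v 0 b -> vge v 1 c ->
  vunit v (a * d - b * c).
Proof.
move=> ua ud b0 c1; have := vunit_det a d b0 c1.
by rewrite ua ud /= => /andP[_ ->].
Qed.

Lemma det2Z (z a b c d : F) :
  z * a * (z * d) - z * b * (z * c) = z ^+ 2 * (a * d - b * c).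
Proof. by ring. Qed.

Lemma det2Z_neq0 (z a b c d : F) : z != 0 -> vunit v (a * d - b * c) ->
  z * a * (z * d) - z * b * (z * c) != 0.
Proof. by move=> z0 /vunit_neq0 D; rewrite det2Z mulf_neq0// expf_neq0. Qed.

Lemma mat2V (a b c d : F) : a * d - b * c != 0 ->
  ((mat2 a b c d)^-1)%g = mat2 (d / (a * d - b * c)) (- b / (a * d - b * c))
    (- c / (a * d - b * c)) (a / (a * d - b * c)).
Proof.
move=> D; apply: (@mulgI _ (mat2 a b c d)); rewrite mulgV mat2M//; last first.
  rewrite (_ : _ - _ = (a * d - b * c)^-1) ?invr_eq0//; by field.
by rewrite -mat2_1; congr mat2; field.
Qed.

Lemma iwahori_mat2 a b c d :
  vunit v a -> vge v 0 b -> vge v 1 c -> vunit v d -> mat2 a b c d \in iwahori v.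
Proof.
move=> ua b0 c1 ud; have D := vunit_detP ua ud b0 c1.
have D0 := vunit_neq0 D; rewrite inE mat2E//= c1 andbT.
have c0 : vge v 0 c by apply: vgeW c1.
have a0 := vunit_vge ua; have d0 := vunit_vge ud; have DV := vunit_vge (vunitV D).
apply/GL2OP => i j; rewrite mat2V// !mat2E//; last first.
  by rewrite (_ : _ - _ = (a * d - b * c)^-1) ?invr_eq0//; field.
by case: (i == 0); case: (j == 0); split => //; apply: vge0M => //; apply: vgeN.
Qed.

(** The determinant is a unit because it and that of the inverse are integral. *)
Lemma iwahoriE k : k \in iwahori v ->
  [/\ vunit v (k 0 0), vge v 0 (k 0 1), vge v 1 (k 1 0) & vunit v (k 1 1)].
Proof.
move=> /andP[/GL2OP Ok k10]; have [k01 _] := Ok 0 1.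
have := vunit_det (k 0 0) (k 1 1) k01 k10.
have [k00 _] := Ok 0 0; have [k11 _] := Ok 1 1.
rewrite [vge v 0 (k 0 0)]k00 [vge v 0 (k 1 1)]k11 /=.
suff -> : vunit v (k 0 0 * k 1 1 - k 0 1 * k 1 0).
  by move/esym/andP => [].
have E i j : (k * k^-1)%g i j = (i == j)%:R by rewrite mulgV GL2_1E.
set D := (X in vunit v X); pose D' := (k^-1)%g 0 0 * (k^-1)%g 1 1 - (k^-1)%g 0 1 * (k^-1)%g 1 0.
have DD' : D * D' = 1.
  have -> : D * D' = (k * k^-1)%g 0 0 * (k * k^-1)%g 1 1 - (k * k^-1)%g 0 1 * (k * k^-1)%g 1 0.
    by rewrite !GL2_mulE /D /D'; ring.
  by rewrite !E /= mulr0 subr0 mulr1.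
have D0 : D != 0 by exact: GL2_det.
have D'0 : D' != 0 by exact: GL2_det.
have VD : vge v 0 D.
  by apply: vgeB; apply: vge0M; case: (Ok 0 0) (Ok 0 1) (Ok 1 0) (Ok 1 1) => ? ? [? ?] [? ?] [? ?].
have VD' : vge v 0 D'.
  by apply: vgeB; apply: vge0M; case: (Ok 0 0) (Ok 0 1) (Ok 1 0) (Ok 1 1) => ? ? [? ?] [? ?] [? ?].
rewrite /vunit /= D0; move: VD VD' (congr1 v DD').
rewrite /vge /= (negPf D0) (negPf D'0) /= valuationM// valuation1; lia.
Qed.

Lemma IZ_intro (z a b c d : F) : z != 0 ->
  vunit v a -> vge v 0 b -> vge v 1 c -> vunit v d ->
  mat2 (z * a) (z * b) (z * c) (z * d) \in IZ v.
Proof.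
move=> z0 ua b0 c1 ud; apply/iwahoriZP.
exists (mat2 a b c d), (mat2 z 0 0 z); split.
- exact: iwahori_mat2.
- by apply/centerP; exists z.
have D := vunit_neq0 (vunit_detP ua ud b0 c1).
have Z : z * z - 0 * 0 != 0 by rewrite mulr0 subr0 mulf_neq0.
by rewrite mat2M//; congr mat2; ring.
Qed.

Lemma IZ_intro1 (a b c d : F) :
  vunit v a -> vge v 0 b -> vge v 1 c -> vunit v d -> mat2 a b c d \in IZ v.
Proof.
move=> ua b0 c1 ud; have := IZ_intro (oner_neq0 _) ua b0 c1 ud.
by rewrite !mul1r.
Qed.

Lemma IZ_scalar z : z != 0 -> mat2 z 0 0 z \in IZ v.
Proof.
move=> z0; have := @IZ_intro z 1 0 0 1 z0 (vunit1 v) (vge0 _ _) (vge0 _ _) (vunit1 v).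
by rewrite mulr0 mulr1.
Qed.

Lemma IZ_elim k : k \in IZ v -> exists z a b c d,
  [/\ z != 0, vunit v a, vge v 0 b, vge v 1 c & vunit v d] /\
  k = mat2 (z * a) (z * b) (z * c) (z * d).
Proof.
move=> /iwahoriZP[k' [_ [/iwahoriE[ua b0 c1 ud] /centerP[z z0 ->] ->]]].
exists z, (k' 0 0), (k' 0 1), (k' 1 0), (k' 1 1); split=> //.
have Z : z * z - 0 * 0 != 0 by rewrite mulr0 subr0 mulf_neq0.
by rewrite {1}[k']mat2_eta mat2M ?GL2_det//; congr mat2; ring.
Qed.

(** [KZ], the stabilizer of the base vertex, as the scalar multiples of integral
    matrices of unit determinant. *)
Definition inKZ g := exists z a b c d,
  [/\ z != 0, vge v 0 a, vge v 0 b, vge v 0 c & vge v 0 d] /\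
  vunit v (a * d - b * c) /\ g = mat2 (z * a) (z * b) (z * c) (z * d).

Lemma KZ_intro1 (a b c d : F) :
  vge v 0 a -> vge v 0 b -> vge v 0 c -> vge v 0 d ->
  vunit v (a * d - b * c) -> inKZ (mat2 a b c d).
Proof.
move=> *; exists 1, a, b, c, d; rewrite !mul1r; split=> //.
by split=> //; exact: oner_neq0.
Qed.

Lemma IZ_KZ k : k \in IZ v -> inKZ k.
Proof.
move=> /IZ_elim[z [a [b [c [d [[z0 ua b0 c1 ud] ->]]]]]].
exists z, a, b, c, d; split; last by split=> //; exact: vunit_detP.
by split=> //; [exact: vunit_vge | apply: vgeW c1 | exact: vunit_vge].
Qed.

Lemma KZM g h : inKZ g -> inKZ h -> inKZ (g * h)%g.
Proof.
move=> [z [a [b [c [d [[z0 a0 b0 c0 d0] [D ->]]]]]]].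
move=> [z' [a' [b' [c' [d' [[z'0 a'0 b'0 c'0 d'0] [D' ->]]]]]]].
exists (z * z'), (a * a' + b * c'), (a * b' + b * d'), (c * a' + d * c'), (c * b' + d * d').
split; first by split; [exact: mulf_neq0 |..]; apply: vgeD; apply: vge0M.
split.
  rewrite (_ : _ - _ = (a * d - b * c) * (a' * d' - b' * c')); last by ring.
  exact: vunitM.
by rewrite mat2M ?det2Z_neq0//; congr mat2; ring.
Qed.

End IwahoriMaximal.

(** * The quotient by image and kernel *)

Section QuotientLinear.
Variables (K : fieldType) (V : lmodType K) (T : {linear V -> V}).

Lemma qpi0 : qpi T 0 = 0.
Proof. by apply: (addrI (qpi T 0)); rewrite -qpiD !addr0. Qed.

Lemma qpi_sum (I : Type) (r : seq I) (P : pred I) (E : I -> V) :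
  qpi T (\sum_(i <- r | P i) E i) = \sum_(i <- r | P i) qpi T (E i).
Proof. exact: (big_morph _ (@qpiD _ _ T) qpi0). Qed.

Lemma qpi_scale a x : qpi T (a *: x) = a *: qpi T x. Proof. exact: qpiZ. Qed.

Lemma qpiB x y : qpi T (x - y) = qpi T x - qpi T y.
Proof. by rewrite -scaleN1r qpiD qpi_scale scaleN1r. Qed.

Lemma qpi_eq0 x : qpi T x = 0 <-> x \in im_add_ker T.
Proof. by rewrite -qpi0 qpi_eq subr0. Qed.

Lemma qpi_im x : qpi T (T x) = 0.
Proof. by apply/qpi_eq0/asboolP; exists x, 0; rewrite linear0 addr0. Qed.

Lemma qpi_ker x : T x = 0 -> qpi T x = 0.
Proof. by move=> Tx; apply/qpi_eq0/asboolP; exists 0, x; rewrite linear0 add0r. Qed.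

End QuotientLinear.

Section Tree.
Variables (F : fieldType) (v : valuation F) (varpi : F).
Hypotheses (pi_neq0 : varpi != 0) (v_pi : v varpi = 1).
Variables (Fq : finFieldType) (res : {rmorphism integers v -> Fq}).
Hypothesis res_ker : forall x, res x = 0 <-> vge v 1 (val x).
Variable teich : Fq -> integers v.
Hypotheses (teichK : cancel teich res) (teichM : {morph teich : x y / x * y}).
Implicit Types (t : Fq) (w : seq Fq).

Local Notation bet := (beta varpi).
Local Notation one := (oneunit v).

(** * Digits of integers *)

Lemma vge_pi : vge v 1 varpi.
Proof. by rewrite /vge /= v_pi lexx orbT. Qed.

Lemma vge0_pi : vge v 0 varpi. Proof. exact: vgeW vge_pi. Qed.

Lemma vge_piX n : vge v n%:Z (varpi ^+ n).
Proof. by rewrite /vge /= valuationX// v_pi mul1r lexx orbT. Qed.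

Lemma vge_divpi n x k : vge v n (x / varpi ^+ k) = vge v (n + k%:Z) x.
Proof. by rewrite vge_div ?expf_neq0// valuationX// v_pi mul1r. Qed.

Lemma vge1_divpi x : vge v 1 x -> vge v 0 (x / varpi).
Proof. by move=> x1; rewrite -[varpi]expr1 vge_divpi. Qed.

(** Reduction and Teichmueller lift with values and arguments in [F], in order to
    compute in the field; [residue] takes the junk value 0 outside of the ring of
    integers. *)
Definition residue (x : F) : Fq := res (insubd (0 : integers v) x).
Definition teichF (t : Fq) : F := val (teich t).

Lemma residue_val x : residue (val x) = res x.
Proof. by rewrite /residue valKd. Qed.

Lemma vge0_val x : vge v 0 x -> exists y : integers v, x = val y.
Proof. by move=> x0; exists (Integers x0). Qed.

Lemma residueD x y : vge v 0 x -> vge v 0 y -> residue (x + y) = residue x + residue y.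
Proof.
move=> /vge0_val[{}x ->] /vge0_val[{}y ->].
by rewrite -[val x + val y]/(val (x + y)) !residue_val rmorphD.
Qed.

Lemma residueB x y : vge v 0 x -> vge v 0 y -> residue (x - y) = residue x - residue y.
Proof.
move=> /vge0_val[{}x ->] /vge0_val[{}y ->].
by rewrite -[val x - val y]/(val (x - y)) !residue_val rmorphB.
Qed.

Lemma residueM x y : vge v 0 x -> vge v 0 y -> residue (x * y) = residue x * residue y.
Proof.
move=> /vge0_val[{}x ->] /vge0_val[{}y ->].
by rewrite -[val x * val y]/(val (x * y)) !residue_val rmorphM.
Qed.

Lemma residue1 : residue 1 = 1.
Proof. by rewrite -[1]/(val (1 : integers v)) residue_val rmorph1. Qed.

Lemma residue0 : residue 0 = 0.
Proof. by rewrite -[0]/(val (0 : integers v)) residue_val rmorph0. Qed.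

Lemma residue_sum (I : Type) (r : seq I) (E : I -> F) :
  (forall i, vge v 0 (E i)) ->
  residue (\sum_(i <- r) E i) = \sum_(i <- r) residue (E i).
Proof.
move=> E0; elim: r => [|i r IHr]; first by rewrite !big_nil residue0.
by rewrite !big_cons residueD ?IHr//; exact: vge_sum.
Qed.

Lemma residue_eq0 x : vge v 0 x -> residue x = 0 <-> vge v 1 x.
Proof. by move=> /vge0_val[{}x ->]; rewrite residue_val. Qed.

Lemma residue_vge1 x : vge v 1 x -> residue x = 0.
Proof. by move=> x1; apply/residue_eq0 => //; apply: vgeW x1. Qed.

Lemma residue_eq x y : vge v 0 x -> vge v 0 y ->
  residue x = residue y <-> vge v 1 (x - y).
Proof.
move=> x0 y0; rewrite -residue_eq0 ?vgeB// residueB//.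
by split=> [->|/eqP]; [rewrite subrr | rewrite subr_eq0 => /eqP].
Qed.

Lemma residue_oneunit x : vge v 1 (x - 1) -> residue x = 1.
Proof.
move=> x1; rewrite -residue1; apply/residue_eq => //; last exact: vge0_1.
exact/vunit_vge/vge1_vunit.
Qed.

Lemma residue_vunit x : vge v 0 x -> residue x != 0 -> vunit v x.
Proof.
move=> x0 rx; have Nx : ~~ vge v 1 x.
  by apply: contra rx => x1; rewrite residue_vge1.
by apply/vunitP; split=> //; apply: contraNneq Nx => ->; rewrite vge0.
Qed.

Lemma vge0_teichF t : vge v 0 (teichF t).
Proof. exact: integersP. Qed.

Lemma residue_teichF t : residue (teichF t) = t.
Proof. by rewrite residue_val. Qed.

Lemma teichFM s t : teichF (s * t) = teichF s * teichF t.
Proof. by rewrite /teichF teichM. Qed.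

Lemma teichF0 : teichF 0 = 0.
Proof.
have /eqP := teichFM 0 0; rewrite mulr0 -subr_eq0 -{1}[teichF 0]mulr1 -mulrBr mulf_eq0.
case/orP=> [/eqP //|/eqP E].
have := congr1 residue E.
rewrite residueB ?vge0_teichF ?vge0_1// residue1 residue_teichF residue0 subr0.
by move/eqP; rewrite oner_eq0.
Qed.

Lemma teichF1 : teichF 1 = 1.
Proof.
have /eqP := teichFM 1 1; rewrite mulr1 -subr_eq0 -{1}[teichF 1]mulr1 -mulrBr mulf_eq0.
case/orP=> [/eqP E|]; last by rewrite subr_eq0 => /eqP.
by have /eqP := congr1 residue E; rewrite residue_teichF residue0 oner_eq0.
Qed.

(** Words list the lowest digit first, so that a child of a vertex is obtained by
    [rcons]. *)
Fixpoint of_digits (w : seq Fq) : F :=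
  if w is t :: w' then teichF t + varpi * of_digits w' else 0.

Definition shift x := (x - teichF (residue x)) / varpi.

Fixpoint digit n x := if n is m.+1 then digit m (shift x) else residue x.

Definition digits n x := mkseq (fun i => digit i x) n.

Lemma vge0_of_digits w : vge v 0 (of_digits w).
Proof.
elim: w => [|t w IHw] /=; first exact: vge0.
by apply: vgeD; [exact: vge0_teichF | apply: vge0M => //; exact: vge0_pi].
Qed.

Lemma of_digits_rcons w t : of_digits (rcons w t) = of_digits w + varpi ^+ size w * teichF t.
Proof.
elim: w => [|s w IHw] /=; first by rewrite mulr0 addr0 add0r mul1r.
by rewrite IHw exprS; ring.
Qed.

Lemma vge0_shift x : vge v 0 x -> vge v 0 (shift x).
Proof.
move=> x0; apply: vge1_divpi; apply/residue_eq; rewrite ?vge0_teichF//.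
by rewrite residue_teichF.
Qed.

Lemma shiftE x : x = teichF (residue x) + varpi * shift x.
Proof. by rewrite /shift mulrC divfK// addrC subrK. Qed.

Lemma residue_cons t y : vge v 0 y -> residue (teichF t + varpi * y) = t.
Proof.
move=> y0; rewrite residueD ?vge0_teichF ?vge0M ?vge0_pi// residue_teichF.
by rewrite [residue _]residue_vge1 ?addr0// mulrC; apply: vge01M => //; exact: vge_pi.
Qed.

Lemma shift_cons t y : vge v 0 y -> shift (teichF t + varpi * y) = y.
Proof. by move=> y0; rewrite /shift residue_cons// addrC addKr mulrC mulKf. Qed.

Lemma digitsS n x : digits n.+1 x = residue x :: digits n (shift x).
Proof.
rewrite /digits /mkseq /= -add1n iotaDl -map_comp; congr (_ :: _).
Qed.

Lemma size_digits n x : size (digits n x) = n. Proof. exact: size_mkseq. Qed.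

Lemma digits_rcons n x : digits n.+1 x = rcons (digits n x) (digit n x).
Proof. exact: mkseqS. Qed.

Lemma digitsP n x : vge v 0 x ->
  exists2 y, vge v 0 y & x = of_digits (digits n x) + varpi ^+ n * y.
Proof.
elim: n x => [|n IHn] x x0; first by exists x; rewrite //= expr0 mul1r add0r.
have [y y0 E] := IHn _ (vge0_shift x0).
by exists y => //; rewrite digitsS /= {1}(shiftE x) {1}E exprS; ring.
Qed.

Lemma digits_of_digits w y : vge v 0 y ->
  digits (size w) (of_digits w + varpi ^+ size w * y) = w.
Proof.
move=> y0; elim: w => [//|t w IHw]; rewrite digitsS.
have -> : of_digits (t :: w) + varpi ^+ size (t :: w) * y =
          teichF t + varpi * (of_digits w + varpi ^+ size w * y).
  by rewrite /= exprS; ring.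
have V : vge v 0 (of_digits w + varpi ^+ size w * y).
  by apply: vgeD; [exact: vge0_of_digits | rewrite vge0M// vge0X// vge0_pi].
by rewrite residue_cons// shift_cons// IHw.
Qed.

Lemma digit_of_digits w k y : vge v 0 y ->
  digit (size w + k) (of_digits w + varpi ^+ size w * y) = digit k y.
Proof.
move=> y0; elim: w => [|t w IHw] /=; first by rewrite add0r mul1r.
have -> : teichF t + varpi * of_digits w + varpi ^+ (size w).+1 * y =
          teichF t + varpi * (of_digits w + varpi ^+ size w * y).
  by rewrite exprS; ring.
rewrite shift_cons//.
by apply: vgeD; [exact: vge0_of_digits | rewrite vge0M// vge0X// vge0_pi].
Qed.

Lemma digitD n x y : vge v 0 x -> vge v 0 y ->
  digit n (x + varpi ^+ n * y) = digit n x + residue y.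
Proof.
elim: n x => [|n IHn] x x0 y0 /=; first by rewrite expr0 mul1r residueD.
have -> : shift (x + varpi ^+ n.+1 * y) = shift x + varpi ^+ n * y.
  rewrite {1}(shiftE x) exprS.
  have -> : teichF (residue x) + varpi * shift x + varpi * varpi ^+ n * y =
            teichF (residue x) + varpi * (shift x + varpi ^+ n * y) by ring.
  by rewrite shift_cons// vgeD// ?vge0_shift// vge0M// vge0X// vge0_pi.
by rewrite IHn// vge0_shift.
Qed.

Lemma digits_eq n x y : vge v 0 x -> vge v 0 y ->
  digits n (x + varpi ^+ n * y) = digits n x.
Proof.
move=> x0 y0; have [z z0 E] := digitsP n x0.
have D := size_digits n x; rewrite {1}E -addrA -mulrDr -{1 3}D.
by rewrite digits_of_digits// vgeD.
Qed.

Lemma of_digits_inj w u : size w = size u ->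
  vge v (size w)%:Z (of_digits w - of_digits u) -> w = u.
Proof.
move=> E V; rewrite -[w](digits_of_digits _ (vge0 v 0)) mulr0 addr0.
pose y := (of_digits w - of_digits u) / varpi ^+ size w.
have y0 : vge v 0 y by rewrite vge_divpi add0r.
have -> : of_digits w = of_digits u + varpi ^+ size w * y.
  by rewrite /y mulrC divfK ?expf_neq0// addrC subrK.
by rewrite E digits_of_digits.
Qed.

(** * Neighbours in the tree *)

Implicit Types g h k : GL2 F.

Lemma det_beta : (0 : F) * 0 - 1 * varpi != 0.
Proof. by rewrite mulr0 sub0r mul1r oppr_eq0. Qed.

Lemma beta_sq : (bet * bet)%g = mat2 varpi 0 0 varpi.
Proof. by rewrite mat2M ?det_beta//; congr mat2; ring. Qed.

(** [beta] normalizes [IZ], being the reversal of the edge that [IZ] fixes. *)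
Lemma beta_IZ k : k \in IZ v ->
  exists2 k', k' \in IZ v & (bet * k = k' * bet)%g /\ (k * bet = bet * k')%g.
Proof.
move=> /IZ_elim[z [a [b [c [d [[z0 ua b0 c1 ud] ->]]]]]].
have D := vunit_detP ua ud b0 c1.
have c0 : vge v 0 (c / varpi) by exact: vge1_divpi.
have b1 : vge v 1 (varpi * b).
  by rewrite mulrC; apply: vge01M => //; exact: vge_pi.
have D' := vunit_detP ud ua c0 b1.
exists (mat2 (z * d) (z * (c / varpi)) (z * (varpi * b)) (z * a)).
  exact: IZ_intro.
rewrite /beta !mat2M ?det_beta ?(det2Z_neq0 z0 D) ?(det2Z_neq0 z0 D')//.
by split; congr mat2; field.
Qed.

(** The edges leaving the source of [g] are [g] and the [g * turn t].  The edge
    [g * child t] goes from a further neighbour of the source of [g] back to this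
    source; it is the reverse of [g * turn t] by [turn_beta].  On the
    vertices below, right multiplication by [child t] appends the digit [t]. *)
Definition turn t : GL2 F := mat2 (teichF t) 1 1 0.
Definition child t : GL2 F := mat2 varpi (teichF t) 0 1.

Lemma det_turn t : teichF t * 0 - 1 * 1 != 0.
Proof. by rewrite mulr0 sub0r oppr_eq0 mulr1 oner_neq0. Qed.

Lemma det_child t : varpi * 1 - teichF t * 0 != 0.
Proof. by rewrite mulr0 subr0 mulr1. Qed.

Lemma KZ_turn t : inKZ v (turn t).
Proof.
apply: KZ_intro1; rewrite ?vge0_1 ?vge0 ?vge0_teichF//.
by rewrite mulr0 mulr1 sub0r vunitN vunit1.
Qed.

Lemma KZ_turnV t : inKZ v ((turn t)^-1)%g.
Proof.
rewrite mat2V ?det_turn// mulr0 mulr1 sub0r invrN1 mulrN1 oppr0 mulrN1 opprK mulrN1.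
apply: KZ_intro1; rewrite ?vge0_1 ?vge0 ?vgeN ?vge0_teichF//.
by rewrite mul0r mulr1 sub0r vunitN vunit1.
Qed.

Lemma child_beta t : (child t * bet)%g = (turn t * mat2 varpi 0 0 varpi)%g.
Proof.
have Z : varpi * varpi - 0 * 0 != 0 by rewrite mulr0 subr0 mulf_neq0.
by rewrite !mat2M ?det_child ?det_turn ?det_beta//; congr mat2; ring.
Qed.

Lemma turn_beta t : (turn t * bet)%g = child t.
Proof.
by rewrite mat2M ?det_turn ?det_beta//; congr mat2; ring.
Qed.

(** Elements of [IZ] fix the edge from [x0] to [x1], so they permute the other
    edges leaving [x0]. *)
Lemma IZ_turn k : k \in IZ v -> exists2 h : Fq -> Fq, injective h &
  forall t, exists2 k', k' \in IZ v & (k * turn t = turn (h t) * k')%g.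
Proof.
move=> /IZ_elim[z [a [b [c [d [[z0 ua b0 c1 ud] ->]]]]]].
have a0 := vunit_vge ua; have d0 := vunit_vge ud.
have c0 : vge v 0 c by apply: vgeW c1.
have D := vunit_detP ua ud b0 c1.
have ra : residue a != 0.
  by apply/eqP => /residue_eq0 H; case/vunitP: ua => _ _; rewrite H.
have rd : residue d != 0.
  by apply/eqP => /residue_eq0 H; case/vunitP: ud => _ _; rewrite H.
exists (fun t => (residue a * t + residue b) / residue d).
  by move=> t u /= E; apply/(mulfI ra)/(addIr (residue b))/(mulIf (invr_neq0 rd)).
move=> t; set t' := _ / _.
have ct : vge v 1 (c * teichF t) by rewrite mulrC vge01M ?vge0_teichF.
have ucd : vunit v (c * teichF t + d) by rewrite addrC; apply: vunitD.
have E1 : vge v 1 (a * teichF t + b - teichF t' * (c * teichF t + d)).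
  have [A B C] : [/\ vge v 0 (a * teichF t + b), vge v 0 (teichF t') &
    vge v 0 (c * teichF t + d)].
    by split; rewrite ?vge0_teichF ?vgeD ?vge0M ?vge0_teichF.
  apply/residue_eq => //; first by rewrite vge0M.
  rewrite residueD ?vge0M ?vge0_teichF// !residueM ?vge0_teichF//.
  rewrite [residue (c * teichF t + d)]residueD ?vge0M ?vge0_teichF//.
  by rewrite (residue_vge1 ct) add0r !residue_teichF// /t' divfK.
have uat : vunit v (a - teichF t' * c) by rewrite vunitB// vge01M ?vge0_teichF.
exists (mat2 (z * (c * teichF t + d)) (z * c)
             (z * (a * teichF t + b - teichF t' * (c * teichF t + d))) (z * (a - teichF t' * c))).
  exact: IZ_intro.
have D' := vunit_detP ucd uat c0 E1.
by rewrite !mat2M ?det_turn ?(det2Z_neq0 z0 D) ?(det2Z_neq0 z0 D')//; congr mat2; ring.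
Qed.

(** The Weyl element [turn 0] exchanges two of the edges leaving [x0] and acts on
    the others by inversion of [t]; multiplicativity of the Teichmueller lift
    makes this exact. *)
Lemma turn0_turn t : t != 0 -> exists2 k', k' \in IZ v &
  (turn 0 * turn t = turn t^-1%R * k')%g.
Proof.
move=> t0; have tmat : teichF t^-1 * teichF t = 1 by rewrite -teichFM mulVf// teichF1.
have ut s : s != 0 -> vunit v (teichF s).
  by move=> s0; apply: residue_vunit; rewrite ?vge0_teichF// residue_teichF.
exists (mat2 (teichF t) 1 0 (- teichF t^-1)).
  by apply: IZ_intro1; rewrite ?vge0_1 ?vge0 ?vunitN ?ut ?invr_eq0.
have D : teichF t * (- teichF t^-1) - 1 * 0 != 0.
  by rewrite mulr0 subr0 mulrN mulrC tmat oppr_eq0 oner_neq0.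
rewrite /turn !mat2M ?det_turn// tmat teichF0.
by congr mat2; ring.
Qed.

Lemma turn0_sq : (turn 0 * turn 0 = 1)%g.
Proof.
by rewrite /turn mat2M ?det_turn// -mat2_1 teichF0; congr mat2; ring.
Qed.

(** Bruhat decomposition. *)
Lemma KZ_cases k : inKZ v k -> k \in IZ v \/
  exists k1 k2, [/\ k1 \in IZ v, k2 \in IZ v & k = (k1 * turn 0 * k2)%g].
Proof.
move=> [z [a [b [c [d [[z0 a0 b0 c0 d0] [D ->]]]]]]].
have [c1|nc1] := boolP (vge v 1 c).
  left; have := vunit_det a d b0 c1; rewrite a0 d0 D /= => /esym/andP[ua ud].
  exact: IZ_intro.
right; have uc : vunit v c.
  by apply/vunitP; split=> //; apply: contraNneq nc1 => ->; rewrite vge0.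
have c_neq0 := vunit_neq0 uc.
pose t := residue (a / c).
have ac : vge v 0 (a / c) by rewrite vge0M// vunit_vge// vunitV.
have V1 : vge v 1 (a - teichF t * c).
  have -> : a - teichF t * c = c * (a / c - teichF t) by field.
  apply: vge01M => //; apply/residue_eq; rewrite ?vge0_teichF//.
  by rewrite residue_teichF.
have V0 : vge v 0 (b - teichF t * d) by rewrite vgeB// vge0M// vge0_teichF.
have D' : vunit v (c * (b - teichF t * d) - d * (a - teichF t * c)).
  rewrite (_ : _ - _ = - (a * d - b * c)); last by ring.
  by rewrite vunitN.
have := vunit_det c (b - teichF t * d) d0 V1.
rewrite c0 V0 D' /= => /esym/andP[_ ub].
exists (mat2 1 (teichF t) 0 1),
  (mat2 (z * c) (z * d) (z * (a - teichF t * c)) (z * (b - teichF t * d))).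
split; first by apply: IZ_intro1; rewrite ?vunit1 ?vge0_teichF ?vge0.
  exact: IZ_intro.
have D1 : 1 * 1 - teichF t * 0 != 0 by rewrite mulr0 subr0 mulr1 oner_neq0.
have -> : (mat2 1 (teichF t) 0 1 * turn 0)%g = turn t.
  rewrite /turn mat2M ?det_turn// teichF0; congr mat2; ring.
by rewrite /turn mat2M ?det_turn ?(det2Z_neq0 z0 D')//; congr mat2; ring.
Qed.

(** The sum over the edges leaving a vertex depends only on this vertex, not on
    the edge [g] that is used to enumerate them ([starsum_KZ]).  Values are taken
    in an arbitrary group, in order to apply this to the brackets themselves. *)
Section StarSum.
Variables (V : zmodType) (psi : GL2 F -> V).
Hypothesis psi_inv : forall g k, k \in IZ v -> psi (g * k)%g = psi g.

Definition starsum g := psi g + \sum_t psi (g * turn t)%g.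

Lemma starsum_IZ g k : k \in IZ v -> starsum (g * k)%g = starsum g.
Proof.
move=> kI; rewrite /starsum psi_inv//; congr (_ + _).
have [h h_inj hP] := IZ_turn kI.
rewrite [RHS](reindex_inj h_inj); apply: eq_bigr => t _.
by have [k' k'I E] := hP t; rewrite -mulgA E mulgA (psi_inv _ k'I).
Qed.

Lemma starsum_turn0 g : starsum (g * turn 0)%g = starsum g.
Proof.
rewrite /starsum (bigD1 0)//= [in RHS](bigD1 0)//= !addrA; congr (_ + _).
  by rewrite -mulgA turn0_sq mulg1 addrC.
rewrite [RHS](reindex_inj invr_inj) /=; apply: eq_big => t; first by rewrite invr_eq0.
by move=> t0; have [k' k'I E] := turn0_turn t0; rewrite -mulgA E mulgA (psi_inv _ k'I).
Qed.

Lemma starsum_KZ g k : inKZ v k -> starsum (g * k)%g = starsum g.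
Proof.
case/KZ_cases=> [|[k1 [k2 [k1I k2I ->]]]]; first exact: starsum_IZ.
by rewrite !mulgA starsum_IZ// starsum_turn0 starsum_IZ.
Qed.

End StarSum.

(** * Representatives of the vertices *)

Definition side (sg : bool) : GL2 F := if sg then bet else 1%g.

(** The vertex with digits [w] on the half of the tree on the side of [x0]; it is
    the base vertex when [w] is empty. *)
Definition half_vertex w : GL2 F := mat2 (varpi ^+ size w) (of_digits w) 0 1.

Definition vertex sg w : GL2 F := (side sg * half_vertex w)%g.

Lemma det_half_vertex w : varpi ^+ size w * 1 - of_digits w * 0 != 0.
Proof. by rewrite mulr0 subr0 mulr1 expf_neq0. Qed.

Lemma half_vertex_nil : half_vertex [::] = 1%g. Proof. by rewrite /half_vertex /= expr0 mat2_1. Qed.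

Lemma vertex_nil sg : vertex sg [::] = side sg.
Proof. by rewrite /vertex half_vertex_nil mulg1. Qed.

Lemma half_vertex_child w t : (half_vertex w * child t)%g = half_vertex (rcons w t).
Proof.
rewrite /half_vertex size_rcons of_digits_rcons exprSr mat2M ?det_half_vertex ?det_child//.
by congr mat2; ring.
Qed.

Lemma vertex_child sg w t : (vertex sg w * child t)%g = vertex sg (rcons w t).
Proof. by rewrite /vertex -mulgA half_vertex_child. Qed.

Lemma KZ_scalar z : z != 0 -> inKZ v (mat2 z 0 0 z).
Proof. by move=> z0; apply: IZ_KZ; exact: IZ_scalar. Qed.

Lemma vertex_parent sg w t :
  exists2 k, inKZ v k & (vertex sg (rcons w t) * bet)%g = (vertex sg w * k)%g.
Proof.
exists (turn t * mat2 varpi 0 0 varpi)%g.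
  by apply: KZM; [exact: KZ_turn | exact: KZ_scalar].
by rewrite -vertex_child -mulgA child_beta.
Qed.

Lemma vertex_root sg :
  exists2 k, inKZ v k & (vertex sg [::] * bet)%g = (vertex (~~ sg) [::] * k)%g.
Proof.
case: sg; rewrite !vertex_nil /= ?mul1g.
  by exists (mat2 varpi 0 0 varpi); [exact: KZ_scalar | rewrite beta_sq mul1g].
exists 1%g; last by rewrite mulg1.
by rewrite -mat2_1; exact/KZ_scalar/oner_neq0.
Qed.

(** A column operation clears the entry below the diagonal, and the upper right
    entry is then only determined modulo the upper left one. *)
Lemma half_vertex_cover_d (a b c d : F) : a * d - b * c != 0 -> d != 0 ->
  vge v 0 (c / d) -> vge v 0 ((a * d - b * c) / d ^+ 2) -> vge v 0 (b / d) ->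
  exists w, exists2 k, inKZ v k & mat2 a b c d = (half_vertex w * k)%g.
Proof.
move=> D d0 cd; set x := _ / d ^+ 2; set y := b / d => x0 y0.
have xN0 : x != 0 by rewrite mulf_neq0// invr_eq0 expf_neq0.
have vx : 0 <= v x by move: x0; rewrite /vge /= (negPf xN0).
pose n := `|v x|%N; have vxn : v x = n%:Z by rewrite /n; lia.
have [r r0 E] := digitsP n y0.
set w := digits n y in E; have sw : size w = n by exact: size_digits.
pose k1 := mat2 (x / varpi ^+ n) r 0 1; pose k2 := mat2 d 0 c d.
have ux : vunit v (x / varpi ^+ n).
  rewrite /vunit /= mulf_neq0 ?invr_eq0 ?expf_neq0//= valuationM ?invr_eq0 ?expf_neq0//.
  by rewrite valuationV ?expf_neq0// valuationX// v_pi vxn; lia.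
have D2 : d * d - 0 * c != 0 by rewrite mul0r subr0 mulf_neq0.
have D1 : x / varpi ^+ n * 1 - r * 0 != 0 by rewrite mulr1 mulr0 subr0 (vunit_neq0 ux).
have D3 : x * 1 - y * 0 != 0 by rewrite mulr1 mulr0 subr0.
exists w, (k1 * k2)%g.
  apply: KZM; first by apply/IZ_KZ/IZ_intro1; rewrite ?vunit1 ?vge0.
  exists d, 1, 0, (c / d), 1; split; first by split=> //; rewrite ?vge0_1 ?vge0.
  split; first by rewrite mul0r subr0 mulr1 vunit1.
  by rewrite mulr1 mulr0 mulrCA divff// mulr1.
have -> : mat2 a b c d = (mat2 x y 0 1 * k2)%g.
  by rewrite mat2M//; congr mat2; rewrite /x /y; field.
rewrite mulgA; congr (_ * _)%g; rewrite mat2M ?det_half_vertex// sw.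
congr mat2; rewrite ?mulr0 ?mul0r ?addr0 ?mulr1 ?add0r//.
  by rewrite mulrC divfK// expf_neq0.
by rewrite addrC.
Qed.

Lemma half_vertex_cover (a b c d : F) : a * d - b * c != 0 ->
  (d != 0) && vge v 0 (c / d) && vge v 0 ((a * d - b * c) / d ^+ 2) && vge v 0 (b / d) ||
  (c != 0) && vge v 0 (d / c) && vge v 0 ((a * d - b * c) / c ^+ 2) && vge v 0 (a / c) ->
  exists w, exists2 k, inKZ v k & mat2 a b c d = (half_vertex w * k)%g.
Proof.
move=> D /orP[/andP[/andP[/andP[d0 cd] xd] bd]|/andP[/andP[/andP[c0 dc] xc] ac]].
  exact: half_vertex_cover_d.
have W : (0 : F) * 0 - 1 * 1 != 0 by rewrite mul0r sub0r oppr_eq0 mulr1 oner_neq0.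
have D' : b * c - a * d != 0 by rewrite -opprB oppr_eq0.
have xc' : vge v 0 ((b * c - a * d) / c ^+ 2) by rewrite -opprB mulNr vgeN.
have [w [k kKZ E]] := half_vertex_cover_d D' c0 dc xc' ac.
exists w, (k * mat2 0 1 1 0)%g.
  apply: KZM kKZ _; apply: KZ_intro1; rewrite ?vge0 ?vge0_1//.
  by rewrite mul0r sub0r mulr1 vunitN vunit1.
by rewrite mulgA -E mat2M//; congr mat2; ring.
Qed.

(** Up to [KZ] the matrix is [(x, y; 0, 1)].  It lies in the half of [x0] when [x]
    and [y] are integral; otherwise the inverse of [beta] brings it there. *)
Lemma vertex_cover g : exists sg w, exists2 k, inKZ v k & g = (vertex sg w * k)%g.
Proof.
have [x [y [k [x0 kKZ ->]]]] : exists x y k, [/\ x != 0, inKZ v k &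
    g = (mat2 x y 0 1 * k)%g].
  rewrite [g]mat2_eta; move: (GL2_det g).
  move: (g 0 0) (g 0 1) (g 1 0) (g 1 1) => a b c d D.
  have H (a' b' c' d' : F) : a' * d' - b' * c' != 0 -> d' != 0 -> vge v 0 (c' / d') ->
      exists x y k, [/\ x != 0, inKZ v k & mat2 a' b' c' d' = (mat2 x y 0 1 * k)%g].
    move=> D' d0 cd; pose x := (a' * d' - b' * c') / d' ^+ 2.
    have xN0 : x != 0 by rewrite mulf_neq0// invr_eq0 expf_neq0.
    exists x, (b' / d'), (mat2 d' 0 c' d'); split=> //.
      exists d', 1, 0, (c' / d'), 1; split; first by split=> //; rewrite ?vge0_1 ?vge0.
      split; first by rewrite mul0r subr0 mulr1 vunit1.
      by rewrite mulr1 mulr0 mulrCA divff// mulr1.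
    rewrite mat2M ?mul0r ?mulr0 ?subr0 ?mulr1 ?mulf_neq0 ?invr_eq0 ?expf_neq0//.
    by congr mat2; rewrite /x; field.
  have [/andP[d0 cd]|N] := boolP ((d != 0) && vge v 0 (c / d)); first exact: H.
  have c0 : c != 0.
    apply: contraNneq N => c0; move: D; rewrite c0 mulr0 subr0 mul0r vge0 andbT.
    by apply: contraNneq => ->; rewrite mulr0.
  have dc : vge v 0 (d / c).
    have [->|d0] := eqVneq d 0; first by rewrite mul0r vge0.
    move: N; rewrite d0 /= /vge /= !mulf_eq0 !invr_eq0 (negPf d0) (negPf c0) /=.
    by rewrite !valuationM ?invr_eq0// !valuationV//; lia.
  have D' : b * c - a * d != 0 by rewrite -opprB oppr_eq0.
  have W : (0 : F) * 0 - 1 * 1 != 0 by rewrite mul0r sub0r oppr_eq0 mulr1 oner_neq0.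
  have [x [y [k [x0 kKZ E]]]] := H b a d c D' c0 dc.
  exists x, y, (k * mat2 0 1 1 0)%g; split=> //.
    apply: KZM kKZ _; apply: KZ_intro1; rewrite ?vge0 ?vge0_1//.
    by rewrite mul0r sub0r mulr1 vunitN vunit1.
  by rewrite mulgA -E mat2M//; congr mat2; ring.
suff [sg [w [k' k'KZ E]]] : exists sg w, exists2 k', inKZ v k' &
    mat2 x y 0 1 = (vertex sg w * k')%g.
  by exists sg, w, (k' * k)%g; [exact: KZM | rewrite mulgA E].
have D : x * 1 - y * 0 != 0 by rewrite mulr1 mulr0 subr0.
have [/andP[x0' y0]|N] := boolP (vge v 0 x && vge v 0 y).
  have [|w [k' k'KZ E]] := half_vertex_cover D; last first.
  - by exists false, w, k'; rewrite // /vertex /= mul1g.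
  - by rewrite oner_neq0 expr1n !divr1 vge0 mulr1 mulr0 subr0 x0' y0.
have D' : 0 * y - varpi^-1 * x != 0.
  by rewrite mul0r sub0r oppr_eq0 mulf_neq0 ?invr_eq0.
have E : mat2 x y 0 1 = (bet * mat2 0 varpi^-1 x y)%g.
  by rewrite mat2M ?det_beta//; congr mat2; field.
(* Now [x] or [y] is not integral; the first alternative holds if [v y <= v x],
   the second if [v x < v y], with [v 0] infinite. *)
suff /(half_vertex_cover D')[w [k' k'KZ E']] : (y != 0) && vge v 0 (x / y) &&
    vge v 0 ((0 * y - varpi^-1 * x) / y ^+ 2) && vge v 0 (varpi^-1 / y) ||
    (x != 0) && vge v 0 (y / x) && vge v 0 ((0 * y - varpi^-1 * x) / x ^+ 2) &&
    vge v 0 (0 / x).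
  by exists true, w, k'; rewrite // E E' mulgA.
rewrite !mul0r sub0r vge0 andbT x0 /=.
have vpx : v (- (varpi^-1 * x)) = v x - 1.
  by rewrite valuationN ?mulf_neq0 ?invr_eq0// valuationM ?invr_eq0// valuationV// v_pi addrC.
have [y_eq0|y0] := eqVneq y 0.
  move: N; rewrite y_eq0 vge0 andbT mul0r vge0 /= /vge /= (negPf x0) /=.
  rewrite mulf_eq0 oppr_eq0 !mulf_eq0 !invr_eq0 (negPf x0) (negPf pi_neq0) /=.
  rewrite expf_eq0 (negPf x0) andbF /=.
  rewrite valuationM ?oppr_eq0 ?mulf_neq0 ?invr_eq0 ?expf_neq0// vpx.
  rewrite valuationV ?expf_neq0// valuationX//; lia.
move: N; rewrite /vge /= (negPf x0) (negPf y0) /= !mulf_eq0 !oppr_eq0 !mulf_eq0 !invr_eq0 !expf_eq0.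
rewrite (negPf x0) (negPf y0) (negPf pi_neq0) !andbF /=.
rewrite !valuationM ?oppr_eq0 ?mulf_neq0 ?invr_eq0 ?expf_neq0// vpx.
rewrite !valuationV ?expf_neq0// !valuationX// v_pi; lia.
Qed.

Lemma half_vertex_inj w u k : inKZ v k -> half_vertex w = (half_vertex u * k)%g -> w = u.
Proof.
move=> [z [a [b [c [d [[z0 a0 b0 c0 d0] [D ->]]]]]]].
have D' := det2Z_neq0 z0 D.
have Du : varpi ^+ size u * 1 - of_digits u * 0 != 0 by exact: det_half_vertex.
rewrite mat2M//; case/mat2_inj.
- exact: det_half_vertex.
- rewrite (_ : _ - _ = varpi ^+ size u * (z ^+ 2 * (a * d - b * c))); last by ring.
  by rewrite !mulf_neq0 ?expf_neq0// (vunit_neq0 D).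
rewrite !mul0r !mul1r !add0r => E1 E2 /esym/eqP.
rewrite mulf_eq0 (negPf z0) /= => /eqP c_eq0 zd.
move: D E1; rewrite c_eq0 !mulr0 subr0 addr0 => D E1.
have [an dn] : a != 0 /\ d != 0.
  by have := vunit_neq0 D; rewrite mulf_eq0 negb_or => /andP.
have va : v a = 0 /\ v d = 0.
  have /andP[_ /eqP] := D; rewrite valuationM//.
  move: a0 d0; rewrite /vge /= (negPf an) (negPf dn) /=.
  by move: (v a) (v d); clear; lia.
have vz : v z = 0.
  by have := congr1 v zd; rewrite valuationM// va.2 addr0 valuation1 => ->.
have sz : size w = size u.
  have := congr1 v E1; rewrite !valuationM ?mulf_neq0 ?expf_neq0// !valuationX// v_pi.
  by rewrite va.1 vz !mul1r !addr0 => -[].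
apply: of_digits_inj => //.
rewrite (_ : _ - _ = varpi ^+ size u * (z * b)); last by rewrite E2 -zd; ring.
rewrite -[_%:Z]addr0.
apply: vgeM; first by rewrite sz; exact: vge_piX.
by apply: vge0M => //; rewrite /vge /= vz lexx orbT.
Qed.

(** The two halves are disjoint: if [z] is the scalar in [k], the upper right entry
    gives [v z <= - size u], and then the determinant [size w + 1 <= - size u]. *)
Lemma beta_half_vertex_neq w u k : inKZ v k -> (bet * half_vertex w)%g <> (half_vertex u * k)%g.
Proof.
move=> [z [a [b [c [d [[z0 a0 b0 c0 d0] [D ->]]]]]]].
have D' := det2Z_neq0 z0 D.
have Du : varpi ^+ size u * 1 - of_digits u * 0 != 0 by exact: det_half_vertex.
have Dw : varpi ^+ size w * 1 - of_digits w * 0 != 0 by exact: det_half_vertex.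
have Db := det_beta.
rewrite !mat2M//; case/mat2_inj.
- rewrite (_ : _ - _ = - (varpi * varpi ^+ size w)); last by ring.
  by rewrite oppr_eq0 mulf_neq0 ?expf_neq0.
- rewrite (_ : _ - _ = varpi ^+ size u * (z ^+ 2 * (a * d - b * c))); last by ring.
  by rewrite !mulf_neq0 ?expf_neq0// (vunit_neq0 D).
rewrite !(mul0r, mul1r, mulr0, mulr1, add0r, addr0) => E1 E2 E3 E4.
have E5 : z * b * varpi ^+ size u = 1 - varpi * (of_digits w * of_digits u).
  by rewrite mulrA E4 [RHS]addrC E2; ring.
have U : vunit v (1 - varpi * (of_digits w * of_digits u)).
  apply: vge1_vunit; rewrite addrAC subrr add0r; apply: vgeN.
  by apply: vge10M; [exact: vge_pi | apply: vge0M; apply: vge0_of_digits].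
have bn : b != 0.
  by apply: contraTneq (vunit_neq0 U) => b_eq0; rewrite -E5 b_eq0 mulr0 mul0r eqxx.
have := congr1 v E5; have /andP[_ /eqP->] := U.
rewrite !valuationM ?mulf_neq0 ?expf_neq0// valuationX// v_pi => vz.
have vb : 0 <= v b by move: b0; rewrite /vge /= (negPf bn).
have E6 : varpi ^+ (size w).+1 = - (varpi ^+ size u * (z ^+ 2 * (a * d - b * c))).
  transitivity (- ((varpi ^+ size u * (z * a) + of_digits u * (z * c)) * (z * d)
     - (varpi ^+ size u * (z * b) + of_digits u * (z * d)) * (z * c))); last by ring.
  by rewrite -E1 -E2 -E3 exprS; ring.
have := congr1 v E6; have /andP[Dn /eqP vD] := D.
rewrite valuationN ?mulf_neq0 ?expf_neq0// !valuationM ?mulf_neq0 ?expf_neq0//.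
rewrite vD !valuationX// v_pi !mul1r addr0; move: vz vb; rewrite !mul1r.
move: (v z) (v b) (size u) (size w); clear; lia.
Qed.

Lemma vertex_inj sg w sg' u k : inKZ v k -> vertex sg w = (vertex sg' u * k)%g ->
  sg = sg' /\ w = u.
Proof.
move=> kKZ; rewrite /vertex /side; case: sg; case: sg'; rewrite ?mul1g.
- by rewrite -mulgA => /(@mulgI _ _ _ _) /(half_vertex_inj kKZ).
- by move/(beta_half_vertex_neq kKZ).
- move/(congr1 (fun y => (bet * y)%g)); rewrite !mulgA beta_sq.
  have : mat2 varpi 0 0 varpi \in @center (GL2 F) by apply/centerP; exists varpi.
  move=> /asboolP ->; rewrite -mulgA => /beta_half_vertex_neq[].
  by apply: KZM => //; exact: KZ_scalar.
- by move/(half_vertex_inj kKZ).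
Qed.

(** * The pro-p Iwahori subgroup acting on digits *)

Lemma pro_p_mat2 (a b c d : F) : one a -> vge v 0 b -> vge v 1 c -> one d ->
  mat2 a b c d \in pro_p_iwahori v.
Proof.
move=> a1 b0 c1 d1; have ua := oneunit_vunit a1; have ud := oneunit_vunit d1.
have /andP[GO _] := iwahori_mat2 ua b0 c1 ud.
have D := vunit_neq0 (vunit_detP ua ud b0 c1).
by rewrite inE GO !mat2E//= c1 /=; apply/andP.
Qed.

Lemma pro_pE h : h \in pro_p_iwahori v -> exists a b c d,
  [/\ one a, vge v 0 b, vge v 1 c & one d] /\ h = mat2 a b c d.
Proof.
move=> /and4P[/GL2OP GO c1 a1 d1]; exists (h 0 0), (h 0 1), (h 1 0), (h 1 1).
by split; [split=> //; case: (GO 0 1) | exact: mat2_eta].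
Qed.

Lemma pro_p_beta h : h \in pro_p_iwahori v ->
  exists2 h', h' \in pro_p_iwahori v & (h * bet = bet * h')%g.
Proof.
move=> /pro_pE[a [b [c [d [[a1 b0 c1 d1] ->]]]]].
have D := vunit_neq0 (vunit_detP (oneunit_vunit a1) (oneunit_vunit d1) b0 c1).
have c0 : vge v 0 (c / varpi) by exact: vge1_divpi.
have b1 : vge v 1 (varpi * b) by apply: vge10M => //; exact: vge_pi.
have D' := vunit_neq0 (vunit_detP (oneunit_vunit d1) (oneunit_vunit a1) c0 b1).
exists (mat2 d (c / varpi) (varpi * b) a); first exact: pro_p_mat2.
by rewrite /beta !mat2M ?det_beta//; congr mat2; field.
Qed.

(** The pro-p Iwahori subgroup acts on the vertices of the half of [x0] by
    Moebius transformations of the integers that their digits represent. *)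
Definition moebius (a b c d x : F) := (a * x + b) / (c * x + d).

Hypotheses (q2 : vge v 2 (#|Fq|%:R : F)) (q3 : (3 < #|Fq|)%N).

Section Fixed.
Variables (a b c d : F).
Hypotheses (a1 : one a) (b0 : vge v 0 b) (c1 : vge v 1 c) (d1 : one d).
Local Notation M := (moebius a b c d).

Lemma moebius_den x : vge v 0 x -> one (c * x + d).
Proof. by move=> x0; rewrite addrC; apply: oneunitD => //; apply: vge10M. Qed.

Lemma moebius_vge0 x : vge v 0 x -> vge v 0 (M x).
Proof.
move=> x0; have e1 := moebius_den x0; apply: vge0M.
  by apply: vgeD => //; apply: vge0M => //; exact: oneunit_vge0.
exact/oneunit_vge0/oneunitV.
Qed.

Lemma det_oneunit : one (a * d - b * c).
Proof. by apply: oneunitB; [exact: oneunitM | exact: vge01M]. Qed.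

Lemma moebiusD x y : vge v 0 x -> vge v 0 y ->
  M (x + y) = M x + y * ((a * d - b * c) / ((c * x + d) * (c * (x + y) + d))).
Proof.
move=> x0 y0; have := oneunit_neq0 (moebius_den x0).
have := oneunit_neq0 (moebius_den (vgeD x0 y0)).
rewrite /moebius => n1 n2; field; by rewrite n1 n2.
Qed.

Lemma moebius_factor x y : vge v 0 x -> vge v 0 y ->
  one ((a * d - b * c) / ((c * x + d) * (c * (x + y) + d))).
Proof.
move=> x0 y0; apply: oneunitM; first exact: det_oneunit.
by apply/oneunitV/oneunitM; apply: moebius_den => //; exact: vgeD.
Qed.

Lemma moebius_half_vertex w : exists2 k, k \in IZ v &
  (mat2 a b c d * half_vertex w = half_vertex (digits (size w) (M (of_digits w))) * k)%g.
Proof.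
have x0 := vge0_of_digits w; have e1 := moebius_den x0.
have [r r0 E] := digitsP (size w) (moebius_vge0 x0).
set w' := digits _ _ in E *; have sw' : size w' = size w by exact: size_digits.
set x := of_digits w in x0 e1 E *.
have D := oneunit_neq0 det_oneunit.
have Dw : varpi ^+ size w * 1 - x * 0 != 0 by exact: det_half_vertex.
have Dw' : varpi ^+ size w' * 1 - of_digits w' * 0 != 0 by exact: det_half_vertex.
have V1 : vge v 1 (of_digits w' * c) by apply: vge01M => //; exact: vge0_of_digits.
have u1 := oneunitB a1 V1.
have V2 : vge v 0 ((c * x + d) * r) by apply: vge0M => //; exact: oneunit_vge0.
have V3 : vge v 1 (c * varpi ^+ size w).
  by apply: vge10M => //; apply: vge0X; exact: vge0_pi.
have D' := vunit_neq0 (vunit_detP (oneunit_vunit u1) (oneunit_vunit e1) V2 V3).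
exists (mat2 (a - of_digits w' * c) ((c * x + d) * r) (c * varpi ^+ size w) (c * x + d)).
  by apply: IZ_intro1 => //; exact: oneunit_vunit.
rewrite !mat2M// sw' -/x; congr mat2; try ring.
have n0 := oneunit_neq0 e1.
have -> : a * x + b * 1 = M x * (c * x + d) by rewrite /moebius mulr1 divfK.
by rewrite E; ring.
Qed.

Lemma moebius_rcons w t :
  M (of_digits (rcons w t)) = M (of_digits w) + varpi ^+ size w *
    (teichF t * ((a * d - b * c) /
      ((c * of_digits w + d) * (c * of_digits (rcons w t) + d)))).
Proof.
have x0 := vge0_of_digits w.
rewrite of_digits_rcons moebiusD//; first by ring.
by apply: vge0M; [apply: vge0X; exact: vge0_pi | exact: vge0_teichF].
Qed.

Lemma moebius_rcons_factor w t :
  one ((a * d - b * c) / ((c * of_digits w + d) * (c * of_digits (rcons w t) + d))).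
Proof.
rewrite of_digits_rcons; apply: moebius_factor; first exact: vge0_of_digits.
by apply: vge0M; [apply: vge0X; exact: vge0_pi | exact: vge0_teichF].
Qed.

(** Adding [varpi ^+ n * y] to the argument of the transformation adds the same
    to its value, up to a factor congruent to 1: the last digit is translated by
    an amount that depends only on the previous ones. *)
Lemma digits_moebius w t : digits (size w).+1 (M (of_digits (rcons w t))) =
  rcons (digits (size w) (M (of_digits w))) (digit (size w) (M (of_digits w)) + t).
Proof.
have x0 := moebius_vge0 (vge0_of_digits w).
have f1 := moebius_rcons_factor w t.
have V : vge v 0 (teichF t * ((a * d - b * c) /
    ((c * of_digits w + d) * (c * of_digits (rcons w t) + d)))).
  by apply: vge0M; [exact: vge0_teichF | exact: oneunit_vge0].
rewrite digits_rcons moebius_rcons digits_eq// digitD//; congr (rcons _ (_ + _)).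
by rewrite residueM ?vge0_teichF ?oneunit_vge0// residue_teichF// (residue_oneunit f1) mulr1.
Qed.

(** With [D s] the factor in [moebius_rcons], the digit is that of
    [z s = r + teichF s * D s] in position one, where [r] does not depend on [s].
    As [s] varies, the digit of [z s] in position zero runs through [Fq], so no
    carry needs to be computed: the sum is the reduction of
    [(q * r + \sum_s teichF s * (D s - 1)) / varpi].  The first term vanishes
    because [q] has valuation at least two.  In the second, [(D s - 1) / varpi]
    reduces to an affine function of [s], and both [\sum_s s] and [\sum_s s ^ 2]
    vanish for [q > 3]. *)
Lemma sum_digit_moebius w :
  \sum_s digit (size w).+1 (M (of_digits (rcons w s))) = 0.
Proof.
have x0 := vge0_of_digits w.
have [r r0 E] := digitsP (size w) (moebius_vge0 x0).
set w' := digits _ _ in E; have sw' : size w' = size w by exact: size_digits.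
pose D s := (a * d - b * c) / ((c * of_digits w + d) * (c * of_digits (rcons w s) + d)).
have D1 s : one (D s) by exact: moebius_rcons_factor.
pose z s := r + teichF s * D s.
have z0 s : vge v 0 (z s).
  by apply: vgeD => //; apply: vge0M; [exact: vge0_teichF | exact: oneunit_vge0].
have dz s : digit (size w).+1 (M (of_digits (rcons w s))) = residue (shift (z s)).
  rewrite moebius_rcons E -addrA -mulrDr -sw' -addn1.
  by rewrite (digit_of_digits w' 1 (z0 s)).
rewrite (eq_bigr _ (fun s _ => dz s)) -residue_sum; last first.
  by move=> s; apply: vge0_shift.
have D0 s : vge v 0 (D s) by exact: oneunit_vge0 (D1 s).
have rz s : residue (z s) = residue r + s.
  rewrite /z residueD//; last by apply: vge0M => //; exact: vge0_teichF.
  rewrite residueM ?vge0_teichF//.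
  by rewrite residue_teichF// (residue_oneunit (D1 s)) mulr1.
have -> : \sum_s shift (z s) =
    #|Fq|%:R / varpi * r + \sum_s teichF s * ((D s - 1) / varpi).
  transitivity ((\sum_s z s - \sum_s teichF (residue r + s)) / varpi).
    by rewrite -sumrB mulr_suml; apply: eq_bigr => s _; rewrite /shift rz.
  have -> : \sum_s teichF (residue r + s) = \sum_s teichF s.
    by rewrite [RHS](reindex_inj (addrI (residue r))).
  rewrite big_split /= -addrA -sumrB.
  rewrite sumr_const mulrDl; congr (_ + _).
    by rewrite -[r *+ _]mulr_natl mulrAC.
  by rewrite mulr_suml; apply: eq_bigr => s _; rewrite mulrA mulrBr mulr1.
have Dpi s : vge v 0 ((D s - 1) / varpi) by exact: (vge1_divpi (D1 s)).
have q1 : vge v 1 (#|Fq|%:R / varpi) by rewrite -[varpi]expr1 vge_divpi.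
rewrite residueD; first last.
- by apply: vge_sum => s; apply: vge0M => //; exact: vge0_teichF.
- by apply: vge0M => //; apply: vgeW q1.
rewrite residue_vge1; last exact: vge10M.
rewrite add0r residue_sum; last by move=> s; apply: vge0M => //; exact: vge0_teichF.
pose al := residue ((D 0 - 1) / varpi).
pose be := residue (c / varpi * varpi ^+ size w).
suff Ds s : residue ((D s - 1) / varpi) = al - be * s.
  rewrite (eq_bigr (fun s => al * s ^+ 1 - be * s ^+ 2)) => [|s _]; last first.
    by rewrite residueM ?vge0_teichF// residue_teichF// Ds expr1 expr2; ring.
  by rewrite sumrB -!mulr_sumr !sum_expr_finField ?mulr0 ?subr0// ltnW.
have Ex := moebius_den x0.
have Es : one (c * of_digits (rcons w s) + d) by apply: moebius_den; exact: vge0_of_digits.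
pose Q := (a * d - b * c) / ((c * of_digits w + d) ^+ 2 * (c * of_digits (rcons w s) + d)).
have Q1 : one Q.
  by apply: oneunitM; [exact: det_oneunit | apply/oneunitV/oneunitM => //; exact: oneunitM].
have cp0 : vge v 0 (c / varpi) by exact: vge1_divpi.
have Vp : vge v 0 (c / varpi * varpi ^+ size w).
  by apply: vge0M => //; apply: vge0X; exact: vge0_pi.
have -> : (D s - 1) / varpi = (D 0 - 1) / varpi - c / varpi * varpi ^+ size w * teichF s * Q.
  have n1 := oneunit_neq0 Ex; have n2 := oneunit_neq0 Es.
  move: n2; rewrite /D /Q !of_digits_rcons teichF0 mulr0 addr0 => n2.
  field; by rewrite pi_neq0 n1 n2.
have Q0 := oneunit_vge0 Q1.
have V3 : vge v 0 (c / varpi * varpi ^+ size w * teichF s).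
  by apply: vge0M => //; exact: vge0_teichF.
rewrite residueB//; last exact: vge0M.
congr (_ - _); rewrite residueM// residueM ?vge0_teichF//.
by rewrite residue_teichF// (residue_oneunit Q1) mulr1.
Qed.

End Fixed.

Lemma pro_p_vertex h sg w : h \in pro_p_iwahori v ->
  exists w' k, [/\ size w' = size w, inKZ v k & (h * vertex sg w = vertex sg w' * k)%g].
Proof.
move=> hP; have [h' h'P E] : exists2 h', h' \in pro_p_iwahori v & (h * side sg = side sg * h')%g.
  by case: sg => /=; [exact: pro_p_beta | exists h; rewrite // mulg1 mul1g].
have [a [b [c [d [[a1 b0 c1 d1] h'E]]]]] := pro_pE h'P.
have [k kI kE] := moebius_half_vertex a1 b0 c1 d1 w.
exists (digits (size w) (moebius a b c d (of_digits w))), k; split; first exact: size_digits.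
  exact: IZ_KZ.
by rewrite /vertex mulgA E -!mulgA h'E kE.
Qed.

(** * Functions on edges and functions on vertices *)

Variables (C : fieldType) (iota : {rmorphism Fq -> C}) (p f : nat).
Hypotheses (p_prime : prime p) (card_Fq : #|Fq| = (p ^ f)%N).
Local Notation ind := (ind v C).
Local Notation br := (br v C).
Implicit Type phi : ind.

Lemma card_Fq_eq0 : #|Fq|%:R = 0 :> C.
Proof.
rewrite card_Fq natrX (pcharf0 (pchar_C iota p_prime card_Fq)) expr0n.
by have := finNzRing_gt1 Fq; rewrite card_Fq; case: (f).
Qed.

Definition ev (phi : ind) : GL2 F -> C := val phi.

Lemma ev_inv (phi : ind) g k : k \in IZ v -> ev phi (g * k)%g = ev phi g.
Proof. by have /asboolP[H _] := cindP phi; apply: H. Qed.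

Lemma evD (phi psi : ind) g : ev (phi + psi) g = ev phi g + ev psi g.
Proof. by []. Qed.

Lemma evZ a (phi : ind) g : ev (a *: phi) g = a * ev phi g.
Proof. by []. Qed.

Lemma evB (phi psi : ind) g : ev (phi - psi) g = ev phi g - ev psi g.
Proof. by []. Qed.

Lemma ev_sum (I : Type) (r : seq I) (P : pred I) (E : I -> ind) g :
  ev (\sum_(i <- r | P i) E i) g = \sum_(i <- r | P i) ev (E i) g.
Proof. by elim/big_ind2: _ => // x1 x2 y1 y2 <- <-. Qed.

Lemma ev_eq (phi psi : ind) : ev phi =1 ev psi -> phi = psi.
Proof. by move=> E; apply/val_inj/funext. Qed.

Lemma ev_br g h : ev (br g) h = ((g^-1 * h)%g \in IZ v)%:R.
Proof. by []. Qed.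

Lemma ev_act g (phi : ind) h : ev (act g phi) h = ev phi (g^-1 * h)%g.
Proof. by []. Qed.

Lemma br_inv g k : k \in IZ v -> br (g * k)%g = br g.
Proof.
move=> kI; apply: ev_eq => h; rewrite !ev_br invgM -mulgA.
by rewrite (gpredMl _ (gpredVr _ kI)).
Qed.

Lemma ind_supp (phi : ind) : exists s : seq (GL2 F), forall g, ev phi g != 0 ->
  exists2 x, x \in s & (x^-1 * g)%g \in IZ v.
Proof. by have /asboolP[_] := cindP phi. Qed.

Lemma ind_ind (P : ind -> Prop) : P 0 ->
  (forall a g phi, P phi -> P (a *: br g + phi)) -> forall phi, P phi.
Proof.
move=> P0 PS phi; have [s] := ind_supp phi.
elim: s phi => [|x s IHs] phi supp.
  rewrite (_ : phi = 0)//; apply: ev_eq => g; apply/eqP.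
  by rewrite -[_ == _]negbK; apply/negP => /supp[].
rewrite -(subrK (ev phi x *: br x) phi) addrC; apply: PS; apply: IHs => g.
rewrite evB evZ ev_br; have [xg|nxg] := boolP ((x^-1 * g)%g \in IZ v).
  rewrite mulr1 (_ : g = (x * (x^-1 * g))%g) ?ev_inv ?subrr ?eqxx//.
  by rewrite mulVKg.
rewrite mulr0 subr0 => /supp[y]; rewrite inE => /orP[/eqP->|ys yg]; last by exists y.
by rewrite (negPf nxg).
Qed.

Variable T : {linear ind -> ind}.
Hypothesis T12 : is_T12 varpi teich T.
Local Notation e g := (qpi T (br g)).
Local Notation inv := (tau_invariants (T := T) (pro_p_iwahori v)).

Local Notation tmat t := (mat2 1 0 (varpi * teichF t) varpi).

Lemma det_tmat t : 1 * varpi - 0 * (varpi * teichF t) != 0.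
Proof. by rewrite mul0r subr0 mul1r. Qed.

Lemma beta_tmat t : (bet * tmat t)%g = (turn t * mat2 varpi 0 0 varpi)%g.
Proof.
have Z : varpi * varpi - 0 * 0 != 0 by rewrite mulr0 subr0 mulf_neq0.
by rewrite !mat2M ?det_turn ?det_beta ?det_tmat//; congr mat2; ring.
Qed.

Lemma T_br_beta g : T (br (g * bet)%g) = starsum br g - br g.
Proof.
rewrite T12 /starsum addrC addKr; apply: eq_bigr => t _.
by rewrite -mulgA beta_tmat mulgA (@br_inv _ (mat2 varpi 0 0 varpi)) ?IZ_scalar.
Qed.

Lemma sum_indicator (P Q : pred Fq) :
  (forall t u, P t -> P u -> t = u) -> (forall t u, Q t -> Q u -> t = u) ->
  ((exists t, P t) <-> (exists t, Q t)) ->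
  \sum_t (P t)%:R = \sum_t (Q t)%:R :> C.
Proof.
move=> uP uQ PQ.
have sumE (P' : pred Fq) t : (forall t u, P' t -> P' u -> t = u) -> P' t ->
    \sum_t (P' t)%:R = 1 :> C.
  move=> uP' Pt; rewrite (bigD1 t)//= Pt big1 ?addr0// => u ut.
  by case: (boolP (P' u)) => // Pu; rewrite (uP' _ _ Pt Pu) eqxx in ut.
have [[t Pt]|nP] := pselect (exists t, P t).
  by have [u Qu] := (PQ.1 (ex_intro _ t Pt)); rewrite (sumE _ _ uP Pt) (sumE _ _ uQ Qu).
rewrite !big1// => t _; first by case: (boolP (Q t)) => // Qt; case: nP; apply/PQ; exists t.
by case: (boolP (P t)) => // Pt; case: nP; exists t.
Qed.

Lemma teichF_eq t u : vge v 1 (teichF t - teichF u) -> t = u.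
Proof.
by move/(residue_eq (vge0_teichF _) (vge0_teichF _)); rewrite !residue_teichF.
Qed.

(** With the next two lemmas: the cosets [tmat t * IZ], on the one hand, and
    [IZ * (child t)^-1], on the other, are disjoint and have the same union, a
    double coset of [IZ]. *)
Lemma tmat_uniq x t u : ((tmat t)^-1 * x)%g \in IZ v -> ((tmat u)^-1 * x)%g \in IZ v -> t = u.
Proof.
move=> tx ux; have : (((tmat u)^-1 * x) * ((tmat t)^-1 * x)^-1)%g \in IZ v.
  by apply: gpredM => //; rewrite gpredV.
rewrite invgM invgK mulgA mulgK => /IZ_elim[z [a [b [c [d [[z0 ua b0 c1 ud] E]]]]]].
have := congr1 (fun y => (tmat u * y)%g) E; rewrite mulVKg.
have D := vunit_detP ua ud b0 c1.
rewrite mat2M ?det_tmat ?(det2Z_neq0 z0 D)// => /mat2_inj[||za _ zc _].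
- by rewrite det_tmat.
- rewrite (_ : _ - _ = varpi * z ^+ 2 * (a * d - b * c)); last by ring.
  by rewrite !mulf_neq0 ?expf_neq0 ?(vunit_neq0 D).
apply: teichF_eq; rewrite mul0r addr0 mul1r in za.
have za1 : z = a^-1 by rewrite -[a^-1]mul1r za mulfK// (vunit_neq0 ua).
have -> : teichF t - teichF u = z * c.
  apply: (mulfI pi_neq0); rewrite mulrBr zc -za; ring.
by rewrite za1 vge01M// vunit_vge// vunitV.
Qed.

Lemma child_uniq x t u : (x * child t)%g \in IZ v -> (x * child u)%g \in IZ v -> t = u.
Proof.
move=> tx ux; have : ((x * child u)^-1 * (x * child t))%g \in IZ v.
  by apply: gpredM => //; rewrite gpredV.
rewrite invgM -mulgA mulKg => /IZ_elim[z [a [b [c [d [[z0 ua b0 c1 ud] E]]]]]].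
have := congr1 (fun y => (child u * y)%g) E; rewrite mulVKg.
have D := vunit_detP ua ud b0 c1.
rewrite mat2M ?det_child ?(det2Z_neq0 z0 D)// => /mat2_inj[||_ zb _ zd].
- by rewrite det_child.
- rewrite (_ : _ - _ = varpi * z ^+ 2 * (a * d - b * c)); last by ring.
  by rewrite !mulf_neq0 ?expf_neq0 ?(vunit_neq0 D).
apply: teichF_eq; rewrite mul0r add0r mul1r in zd.
have zd1 : z = d^-1 by rewrite -[d^-1]mul1r zd mulfK// (vunit_neq0 ud).
have -> : teichF t - teichF u = z * b * varpi.
  by rewrite zb -zd; ring.
apply: vge01M; last exact: vge_pi.
by rewrite zd1 vge0M// vunit_vge// vunitV.
Qed.

Lemma tmat_child x :
  (exists t, ((tmat t)^-1 * x)%g \in IZ v) <-> (exists t, (x * child t)%g \in IZ v).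
Proof.
split=> [[t /IZ_elim[z [a [b [c [d [[z0 ua b0 c1 ud] E]]]]]]]|
         [t /IZ_elim[z [a [b [c [d [[z0 ua b0 c1 ud] E]]]]]]]].
all: have D := vunit_detP ua ud b0 c1.
all: have a0 := vunit_vge ua; have a_neq0 := vunit_neq0 ua.
all: have aV : vge v 0 a^-1 by rewrite vunit_vge ?vunitV.
  have {}E : x = (tmat t * mat2 (z * a) (z * b) (z * c) (z * d))%g by rewrite -E mulVKg.
  pose u := residue (- b / a).
  have V : vge v 1 (a * teichF u + b).
    have -> : a * teichF u + b = a * (teichF u - (- b / a)) by field.
    apply: vge01M => //; apply/residue_eq; rewrite ?vge0_teichF ?residue_teichF//.
    by rewrite vge0M ?vgeN.
  exists u; rewrite E !mat2M ?det_tmat ?det_child ?(det2Z_neq0 z0 D)//; last first.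
    rewrite (_ : _ - _ = varpi * z ^+ 2 * (a * d - b * c)); last by ring.
    by rewrite !mulf_neq0 ?expf_neq0 ?(vunit_neq0 D).
  have zp : z * varpi != 0 by rewrite mulf_neq0.
  have V' : vge v 0 ((a * teichF u + b) / varpi) by exact: vge1_divpi.
  have c1' : vge v 1 (varpi * (teichF t * a + c)).
    rewrite mulrC; apply: vge01M; last exact: vge_pi.
    by rewrite vgeD// ?vge0M ?vge0_teichF//; apply: vgeW c1.
  have ud' : vunit v (teichF t * (a * teichF u + b) + (c * teichF u + d)).
    rewrite addrA addrC; apply: vunitD => //.
    by apply: vgeD; [apply: vge01M | apply: vge10M]; rewrite ?vge0_teichF.
  have kI := IZ_intro zp ua V' c1' ud'; apply: etrans kI; congr in_mem.
  by congr mat2; field.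
have cV : vge v 0 (c / varpi) by exact: vge1_divpi.
pose u := residue (c / varpi / a).
have V : vge v 1 (c / varpi - teichF u * a).
  have -> : c / varpi - teichF u * a = a * (c / varpi / a - teichF u).
    by field; rewrite a_neq0.
  by apply: vge01M => //; apply/residue_eq; rewrite ?vge0_teichF ?residue_teichF //; exact: vge0M.
have V0 : vge v 0 (varpi * b - a * teichF t).
  by rewrite vgeB// vge0M ?vge0_teichF// vge0_pi.
have ud' : vunit v (d - teichF t * (c / varpi - teichF u * a) - teichF u * (varpi * b)).
  apply: vunitB; last by apply: vge01M; [exact: vge0_teichF | exact: vge10M vge_pi b0].
  by apply: vunitB => //; apply: vge01M => //; exact: vge0_teichF.
have zp : z / varpi != 0 by rewrite mulf_neq0 ?invr_eq0.
have kI := IZ_intro zp ua V0 V ud'.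
exists u; set k := (X in X \in _) in kI; suff -> : x = (tmat u * k)%g by rewrite mulKg.
have D' := vunit_detP ua ud' V0 V.
apply: (@mulIg _ (child t)); rewrite E /k -mulgA.
rewrite (mat2M (det2Z_neq0 zp D') (det_child t)) mat2M ?det_tmat//.
  by congr mat2; field.
set x1 := _ - teichF u * _ in D' *; set y := (X in X != 0).
rewrite (_ : y = varpi * ((z / varpi) ^+ 2 *
    (a * x1 - (varpi * b - a * teichF t) * (c / varpi - teichF u * a)))).
  by rewrite mulf_neq0// mulf_neq0 ?expf_neq0// (vunit_neq0 D').
by rewrite /y; ring.
Qed.

(** [T] acts on functions by summing over the edges that lead to the source of
    [g], its reverse excepted. *)
Lemma T_ev phi g : ev (T phi) g = \sum_t ev phi (g * child t)%g.
Proof.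
elim/ind_ind: phi => [|a h phi IHphi].
  by rewrite linear0 big1.
rewrite linearP evD evZ IHphi T12.
under [RHS]eq_bigr do rewrite evD evZ.
rewrite big_split -mulr_sumr; congr (_ * _ + _).
rewrite ev_sum.
under eq_bigr do rewrite ev_br invgM -mulgA.
under [RHS]eq_bigr do rewrite ev_br mulgA.
apply: (@sum_indicator (fun t => ((tmat t)^-1 * (h^-1 * g))%g \in IZ v)
                       (fun t => (h^-1 * g * child t)%g \in IZ v)).
- exact: tmat_uniq.
- exact: child_uniq.
- exact: tmat_child.
Qed.

Lemma T_act h (phi : ind) : T (act h phi) = act h (T phi).
Proof.
have TE := T_ev.
apply: ev_eq => g; rewrite ev_act !TE.
by apply: eq_bigr => t _; rewrite ev_act mulgA.
Qed.

Lemma actD h (phi psi : ind) : act h (phi + psi) = act h phi + act h psi.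
Proof. exact: ev_eq. Qed.

Lemma actB h (phi psi : ind) : act h (phi - psi) = act h phi - act h psi.
Proof. exact: ev_eq. Qed.

Lemma act_scale h a (phi : ind) : act h (a *: phi) = a *: act h phi.
Proof. exact: ev_eq. Qed.

Lemma act_sum h (I : Type) (r : seq I) (P : pred I) (E : I -> ind) :
  act h (\sum_(i <- r | P i) E i) = \sum_(i <- r | P i) act h (E i) :> ind.
Proof. by apply: ev_eq => g; rewrite ev_act !ev_sum. Qed.

Lemma act_br h g : act h (br g) = br (h * g)%g.
Proof. exact: act_bracket. Qed.

Lemma actM h h' (phi : ind) : act h (act h' phi) = act (h * h')%g phi :> ind.
Proof. by apply: ev_eq => g; rewrite !ev_act invgM mulgA. Qed.

Lemma qpi_act h (phi psi : ind) :
  qpi T phi = qpi T psi -> qpi T (act h phi) = qpi T (act h psi).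
Proof.
move=> /qpi_eq/asboolP[y [z [Tz E]]]; apply/qpi_eq/asboolP.
exists (act h y), (act h z); rewrite T_act Tz; split.
  by apply: ev_eq => g; rewrite ev_act.
by rewrite -actB E actD T_act.
Qed.

Lemma tau_actE h (phi : ind) : tau_act (T := T) h (qpi T phi) = qpi T (act h phi).
Proof. by apply: qpi_act; exact: qpi_repr. Qed.

(** Edges with the same source agree in [tau]: [T] sends the reverse of an edge to
    the other edges leaving the same vertex, so the difference of two images is
    the difference of two such edges. *)
Lemma e_turn0 g : e (g * turn 0)%g = e g.
Proof.
apply/eqP; rewrite -subr_eq0 -qpiB.
have TB := T_br_beta.
rewrite (_ : _ - _ = T (br (g * bet)%g - br (g * turn 0 * bet)%g)) ?qpi_im//.
rewrite linearB !TB (starsum_turn0 (@br_inv)).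
by rewrite opprB [RHS]addrC addrA subrK.
Qed.

Lemma e_KZ g k : inKZ v k -> e (g * k)%g = e g.
Proof.
case/KZ_cases => [kI|[k1 [k2 [k1I k2I ->]]]].
  by rewrite br_inv.
by rewrite !mulgA br_inv// e_turn0 br_inv.
Qed.

(** The edges [x -> y] for a fixed vertex [y], the source of [g]. *)
Definition in_edges g : ind := br (g * bet)%g + \sum_t br (g * child t)%g.

(** Every edge leaving [y] arises from the [q] edges that lead to [y] without being
    its reverse. *)
Lemma T_in_edges g : T (in_edges g) = 0.
Proof.
have TB := T_br_beta.
have SK := starsum_KZ (@br_inv).
rewrite /in_edges linearD linear_sum TB /=.
rewrite (eq_bigr (fun t => starsum br g - br (g * turn t)%g)).
  rewrite sumrB sumr_const -[_ *+ #|_|]scaler_nat card_Fq_eq0 scale0r sub0r.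
  by rewrite {1}/starsum [br g + _]addrC addrK subrr.
by move=> t _; rewrite -turn_beta mulgA TB SK//; exact: KZ_turn.
Qed.

Lemma e_in_edges g : e (g * bet)%g + \sum_t e (g * child t)%g = 0.
Proof. by rewrite -qpi_sum -qpiD; apply: qpi_ker; exact: T_in_edges. Qed.

(** The linear map from functions on edges to functions on vertices that sends an
    edge [x -> y] to its source [x]. *)
Definition vertex_sum (phi : ind) : GL2 F -> C := starsum (ev phi).

Lemma vertex_sum_KZ phi g k : inKZ v k -> vertex_sum phi (g * k)%g = vertex_sum phi g.
Proof. exact: (starsum_KZ (ev_inv phi)). Qed.

(** The neighbours of the vertex of [g] are those of [g * bet] and [g * child t]. *)
Definition adjacency (c : GL2 F -> C) g := c (g * bet)%g + \sum_t c (g * child t)%g.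

Definition KZinv (c : GL2 F -> C) := forall g k, inKZ v k -> c (g * k)%g = c g.

Definition depth_le n (c : GL2 F -> C) := forall sg w, (n < size w)%N -> c (vertex sg w) = 0.

Lemma beta_cancel (phi : ind) g : ev phi (g * bet * bet)%g = ev phi g.
Proof. by rewrite -mulgA beta_sq ev_inv// IZ_scalar. Qed.

Lemma ev_beta_inv (phi : ind) g k : k \in IZ v ->
  ev phi (g * k * bet)%g = ev phi (g * bet)%g.
Proof.
move=> /beta_IZ[k' k'I [_ E]].
by rewrite -mulgA E mulgA (ev_inv _ _ k'I).
Qed.

(** [T phi] at an edge leaving [y] is the total of [phi] on the edges to [y], minus
    its value at the reverse; the sum over the [q + 1] edges is [q] times the
    total. *)
Lemma vertex_sum_im (phi : ind) g : vertex_sum (T phi) g = 0.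
Proof.
have TE := T_ev.
pose c g := ev phi (g * bet)%g.
have SK g' k : inKZ v k -> starsum c (g' * k)%g = starsum c g'.
  exact: (starsum_KZ (@ev_beta_inv phi)).
have E g' : ev (T phi) g' = starsum c g' - c g'.
  rewrite TE /starsum addrC addKr; apply: eq_bigr => t _.
  by rewrite /c -mulgA turn_beta.
rewrite /vertex_sum {1}/starsum E (eq_bigr (fun t => starsum c g - c (g * turn t)%g)).
  rewrite sumrB sumr_const -[_ *+ #|_|]mulr_natl card_Fq_eq0 mul0r sub0r.
  by rewrite {1}/starsum [c g + _]addrC addrK subrr.
by move=> t _; rewrite E SK//; exact: KZ_turn.
Qed.

Lemma flip_depth (phi : ind) : exists n, depth_le n (fun g => ev phi (g * bet)%g).
Proof.
have [s supp] := ind_supp phi.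
have [n nP] : exists n, forall x, x \in s -> exists sg w,
    exists2 k, inKZ v k & (x * bet)%g = (vertex sg w * k)%g /\ (size w <= n)%N.
  elim: s {supp} => [|x s [n nP]]; first by exists 0%N.
  have [sg [w [k kKZ E]]] := vertex_cover (x * bet)%g.
  exists (maxn n (size w)) => y; rewrite inE => /orP[/eqP->|/nP].
    by exists sg, w, k; rewrite // leq_max leqnn orbT.
  by move=> [sg' [u [k' k'KZ [E' un]]]]; exists sg', u, k'; rewrite // leq_max un.
exists n => sg w nw; apply/eqP; apply: contraTT nw => /supp[x xs].
set k := (_ * _)%g => kI; rewrite -leqNgt.
have [k' k'I [_ kbE]] := beta_IZ kI.
have [sg' [u [k1 k1KZ [E un]]]] := nP x xs.
have bb : ((bet * bet)^-1)%g \in IZ v by rewrite gpredV beta_sq IZ_scalar.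
have [||_ ->//] := @vertex_inj sg w sg' u (k1 * k' * (bet * bet)^-1)%g.
  by do ![apply: KZM] => //; exact: IZ_KZ.
rewrite !mulgA -E -[(x * bet * k')%g]mulgA -kbE /k !mulgA mulgV mul1g.
by rewrite -[(_ * bet * bet)%g]mulgA mulgK.
Qed.

(** Write [phi = T y + z] with [T z = 0].  The second condition says that
    [c g = ev z (g * bet)] equals its own sum over the edges leaving a vertex, so
    [z] depends only on the target of an edge.  Summing it over the edges that
    leave a vertex then gives the sum of [c] over the neighbours. *)
Lemma qpi_eq0_adjacency (phi : ind) : qpi T phi = 0 -> exists c,
  [/\ KZinv c, exists n, depth_le n c & vertex_sum phi =1 adjacency c].
Proof.
move=> /qpi_eq0/asboolP[y [z [Tz ->]]].
have TE := T_ev.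
pose c g := ev z (g * bet)%g.
have SK g' k : inKZ v k -> starsum c (g' * k)%g = starsum c g'.
  exact: (starsum_KZ (@ev_beta_inv z)).
have cS g : c g = starsum c g.
  rewrite /starsum -[LHS]addr0; congr (_ + _).
  transitivity (ev (T z) g); first by rewrite Tz.
  by rewrite TE; apply: eq_bigr => t _; rewrite /c -mulgA turn_beta.
exists c; split; last 1 first.
- move=> g; have -> : vertex_sum (T y + z) g = vertex_sum (T y) g + vertex_sum z g.
    rewrite /vertex_sum /starsum evD; under eq_bigr do rewrite evD.
    by rewrite big_split /= addrACA.
  rewrite vertex_sum_im add0r /vertex_sum /starsum /adjacency /c beta_cancel; congr (_ + _).
  apply: eq_bigr => t _; rewrite -[(g * child t * bet)%g]mulgA child_beta.
  by rewrite mulgA (ev_inv _ _ (IZ_scalar v pi_neq0)).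
- by move=> g k kKZ; rewrite !cS SK.
- exact: flip_depth.
Qed.

Lemma vertex_sumD phi psi g : vertex_sum (phi + psi) g = vertex_sum phi g + vertex_sum psi g.
Proof.
rewrite /vertex_sum /starsum evD.
rewrite (eq_bigr (fun t => ev phi (g * turn t)%g + ev psi (g * turn t)%g)) => [|t _ //].
by rewrite big_split addrACA.
Qed.

Lemma vertex_sum_scale a phi g : vertex_sum (a *: phi) g = a * vertex_sum phi g.
Proof. by rewrite /vertex_sum /starsum mulrDr mulr_sumr. Qed.

Lemma vertex_sumB phi psi g : vertex_sum (phi - psi) g = vertex_sum phi g - vertex_sum psi g.
Proof. by rewrite -scaleN1r vertex_sumD vertex_sum_scale mulN1r. Qed.

Lemma vertex_sum0 g : vertex_sum (0 : ind) g = 0.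
Proof. by rewrite -(scale0r (0 : ind)) vertex_sum_scale mul0r. Qed.

Lemma vertex_sum_sum (I : Type) (r : seq I) (P : pred I) (E : I -> ind) g :
  vertex_sum (\sum_(i <- r | P i) E i) g = \sum_(i <- r | P i) vertex_sum (E i) g.
Proof.
exact: (big_morph (fun phi => vertex_sum phi g) (fun a b => vertex_sumD a b g)
  (vertex_sum0 g)).
Qed.

Lemma vertex_sum_act h phi g : vertex_sum (act h phi) g = vertex_sum phi (h^-1 * g)%g.
Proof.
rewrite /vertex_sum /starsum ev_act; congr (_ + _).
by apply: eq_bigr => t _; rewrite ev_act mulgA.
Qed.

Lemma vertex_sum_br_KZ g k x : inKZ v k -> vertex_sum (br (g * k)%g) x = vertex_sum (br g) x.
Proof.
case/KZ_cases => [kI|[k1 [k2 [k1I k2I ->]]]].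
  by rewrite br_inv.
rewrite !mulgA br_inv//; rewrite -[in RHS](br_inv _ k1I).
move: (g * k1)%g => {}g.
have TB := T_br_beta.
apply/eqP; rewrite -subr_eq0 -vertex_sumB.
rewrite (_ : _ - _ = T (br (g * bet)%g - br (g * turn 0 * bet)%g)).
  by rewrite vertex_sum_im.
rewrite linearB !TB (starsum_turn0 (@br_inv)).
by rewrite opprB [RHS]addrC addrA subrK.
Qed.

Lemma turn_notin_IZ t : turn t \notin IZ v.
Proof.
apply/negP => /IZ_elim[z [a [b [c [d [[z0 ua b0 c1 ud] E]]]]]].
have D := det2Z_neq0 z0 (vunit_detP ua ud b0 c1).
move: E => /mat2_inj[|//|_ _ _ /esym/eqP]; first exact: det_turn.
by rewrite mulf_eq0 (negPf z0) (negPf (vunit_neq0 ud)).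
Qed.

Lemma vertex_sum_br sg w sg' u :
  vertex_sum (br (vertex sg w)) (vertex sg' u) = ((sg == sg') && (w == u))%:R.
Proof.
rewrite /vertex_sum /starsum ev_br; have [/andP[/eqP<- /eqP<-]|N] := boolP (_ && _).
  rewrite mulVg gpred1 big1 ?addr0// => t _.
  by rewrite ev_br mulKg (negPf (turn_notin_IZ t)).
have NKZ k : inKZ v k -> vertex sg' u <> (vertex sg w * k)%g.
  move=> kKZ /(vertex_inj kKZ)[E1 E2].
  by rewrite E1 E2 !eqxx in N.
rewrite big1 ?addr0 => [|t _].
  case: (boolP (_ \in _)) => // /IZ_KZ/NKZ; rewrite mulVKg; by case.
rewrite ev_br; case: (boolP (_ \in _)) => // /IZ_KZ H; exfalso.
apply: (NKZ _ (KZM H (KZ_turnV t))).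
by rewrite mulgA mulVKg mulgK.
Qed.

Lemma vertex_sum_depth phi : exists n, depth_le n (vertex_sum phi).
Proof.
elim/ind_ind: phi => [|a g phi [n nP]].
  by exists 0%N => sg w _; rewrite vertex_sum0.
have [sg [w [k kKZ ->]]] := vertex_cover g.
exists (maxn n (size w)) => sg' u; rewrite gtn_max => /andP[nu wu].
rewrite vertex_sumD vertex_sum_scale nP// vertex_sum_br_KZ// vertex_sum_br andbC.
by case: eqVneq wu => [->|_ _]; rewrite ?ltnn// mulr0 addr0.
Qed.

(** Reversing the edges gives explicit preimages under [T], see
    [vertex_sum_eq0]. *)
Fact flip_proof phi : (fun g => ev phi (g * bet)%g : C^o) \in @cind_pred _ (IZ v) C.
Proof.
apply/asboolP; split=> [g k kI|].
  exact: (ev_beta_inv phi g kI).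
have [s supp] := ind_supp phi; exists [seq (x * bet^-1)%g | x <- s] => g /supp[x xs kI].
have [k' k'I [E _]] := beta_IZ kI.
exists (x * bet^-1)%g; first exact: map_f.
by rewrite invgM invgK (_ : _ * _ = k')%g// -[RHS](mulgK bet) -E !mulgA mulgK.
Qed.

Definition flip phi : ind := Cind (flip_proof phi).

(** If the values of [phi] on the edges leaving each vertex add up to zero, then
    [phi] is minus the image under [T] of its reversal. *)
Lemma vertex_sum_eq0 phi : (forall sg w, vertex_sum phi (vertex sg w) = 0) -> qpi T phi = 0.
Proof.
move=> phi0; rewrite (_ : phi = T (- flip phi)) ?qpi_im//.
have TE := T_ev.
rewrite linearN; apply: ev_eq => g.
have : vertex_sum phi g = 0.
  have [sg [w [k kKZ ->]]] := vertex_cover g.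
  by rewrite vertex_sum_KZ.
rewrite /vertex_sum /starsum => /eqP; rewrite addr_eq0 => /eqP ->.
rewrite -[ev (- _) g]/(- ev _ g) TE; congr (- _); apply: eq_bigr => t _.
rewrite -[ev (flip phi) _]/(ev phi _) -mulgA child_beta mulgA.
by rewrite (ev_inv _ _ (IZ_scalar v pi_neq0)).
Qed.

Lemma adjacency_rcons c sg w t : KZinv c ->
  adjacency c (vertex sg (rcons w t)) =
  c (vertex sg w) + \sum_s c (vertex sg (rcons (rcons w t) s)).
Proof.
move=> cKZ; have [k kKZ E] := vertex_parent sg w t.
rewrite /adjacency E cKZ//; congr (_ + _); apply: eq_bigr => s _.
by rewrite vertex_child.
Qed.

Lemma adjacency_nil c sg : KZinv c ->
  adjacency c (vertex sg [::]) = c (vertex (~~ sg) [::]) + \sum_s c (vertex sg [:: s]).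
Proof.
move=> cKZ; have [k kKZ E] := vertex_root sg.
rewrite /adjacency E cKZ//; congr (_ + _); apply: eq_bigr => s _.
by rewrite vertex_child.
Qed.

(** At a child of [w], the adjacency operator gives the value at [w] plus values
    two layers further out, which vanish by descending induction on the depth.
    One child of each vertex is enough. *)
Lemma adjacency_inj n m c : KZinv c -> depth_le m c ->
  (forall sg w, (n <= size w)%N -> exists t, adjacency c (vertex sg (rcons w t)) = 0) ->
  forall sg w, (n <= size w)%N -> c (vertex sg w) = 0.
Proof.
move=> cKZ cm c0 sg w nw.
have [k mk] : exists k : nat, (m < size w + k)%N by exists m.+1; rewrite addnS ltnS leq_addl.
elim: k w nw mk => [|k IHk] w nw mw; first by apply: cm; rewrite -[size w]addn0.
have [t] := c0 sg w nw; rewrite adjacency_rcons// big1 ?addr0// => s _.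
apply: IHk; rewrite !size_rcons; first by rewrite (leq_trans nw)// ltnW.
by move: mw; rewrite addnS -addSn => /leq_trans; apply; rewrite leq_add2r ltnS.
Qed.

Lemma adjacency_depth n m c : KZinv c -> depth_le m c ->
  depth_le n.+1 (adjacency c) -> depth_le n c.
Proof.
move=> cKZ cm cn sg w; apply: (adjacency_inj cKZ cm) => {}sg {}w nw.
by exists 0; apply: cn; rewrite size_rcons.
Qed.

Lemma vertex_sum_in_edges sg w sg' u : (size w < size u)%N ->
  vertex_sum (in_edges (vertex sg w)) (vertex sg' u) = \sum_t ((sg == sg') && (rcons w t == u))%:R.
Proof.
move=> wu; rewrite /in_edges vertex_sumD vertex_sum_sum.
rewrite [X in X + _](_ : _ = 0) ?add0r.
  by apply: eq_bigr => t _; rewrite vertex_child vertex_sum_br.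
case/lastP: w wu => [|w t] wu.
  have [k kKZ ->] := vertex_root sg.
  rewrite vertex_sum_br_KZ// vertex_sum_br; case: (u) wu => //= *; by rewrite andbF.
have [k kKZ ->] := vertex_parent sg w t.
rewrite vertex_sum_br_KZ// vertex_sum_br andbC; case: eqVneq wu => // ->.
by rewrite size_rcons => /ltnW; rewrite ltnn.
Qed.

(** A function on the outermost layer that does not depend on the last digit is a
    combination of sums of children, which the relations turn into the parents,
    two layers further in. *)
Lemma reduce_depth n phi (a : bool -> seq Fq -> C) : depth_le n.+1 (vertex_sum phi) ->
  (forall sg w t, size w = n -> vertex_sum phi (vertex sg (rcons w t)) = a sg w) ->
  exists2 psi, qpi T psi = qpi T phi & depth_le n (vertex_sum psi).
Proof.
move=> phin phia.
pose D := \sum_(sg : bool) \sum_(w : n.-tuple Fq) a sg w *: in_edges (vertex sg w).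
exists (phi - D).
  rewrite qpiB [X in _ - X](_ : _ = 0) ?subr0// qpi_sum big1// => sg _.
  rewrite qpi_sum big1// => w _; rewrite qpi_scale qpi_ker ?scaler0//.
  exact: T_in_edges.
move=> sg; case/lastP=> [//|u t]; rewrite size_rcons ltnS => nu.
have DE : vertex_sum D (vertex sg (rcons u t)) = if size u == n then a sg u else 0.
  rewrite vertex_sum_sum (bigD1 sg)//= [X in _ + X]big1 ?addr0; last first.
    move=> sg' ne; rewrite vertex_sum_sum big1// => w _.
    rewrite vertex_sum_scale vertex_sum_in_edges.
      by rewrite big1 ?mulr0// => s _; rewrite (negPf ne).
    by rewrite size_tuple size_rcons.
  rewrite vertex_sum_sum.
  have H (w : n.-tuple Fq) : vertex_sum (a sg w *: in_edges (vertex sg w)) (vertex sg (rcons u t)) =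
      a sg w * (tval w == u)%:R.
    rewrite vertex_sum_scale vertex_sum_in_edges ?size_tuple ?size_rcons//; congr (_ * _).
    rewrite (bigD1 t)//= eqxx eqseq_rcons eqxx andbT big1 ?addr0// => s st.
    by rewrite eqseq_rcons (negPf st) andbF.
  under eq_bigr do rewrite H.
  case: eqVneq => [un|nun]; last first.
    rewrite big1// => w _; rewrite (_ : _ == u = false) ?mulr0//.
    by apply/negbTE; apply: contra nun => /eqP <-; rewrite size_tuple.
  have un' : size u == n by apply/eqP.
  rewrite (bigD1 (Tuple un'))//= eqxx mulr1 big1 ?addr0// => w wu.
  by rewrite (_ : _ == u = false) ?mulr0//; exact: negbTE.
rewrite vertex_sumB DE; case: eqVneq => [un|nun]; first by rewrite phia// subrr.
by rewrite phin ?subrr// size_rcons ltnS ltn_neqAle eq_sym nun.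
Qed.

(** * Invariance of the elements s_n^(p^l) *)

Local Notation s := (@s F v C varpi Fq teich iota).

Lemma sum_tuple_rcons (V : nmodType) n (E : seq Fq -> V) :
  \sum_(mu : n.+1.-tuple Fq) E mu = \sum_(w : n.-tuple Fq) \sum_t E (rcons w t).
Proof.
rewrite pair_big /=; pose h (x : n.-tuple Fq * Fq) : n.+1.-tuple Fq := [tuple of rcons x.1 x.2].
have h_inj : injective h.
  move=> [w t] [u t'] /(congr1 val)/= /rcons_inj[E1 ->]; congr (_, _).
  exact: val_inj.
have h_bij : bijective h.
  apply: inj_card_bij h_inj _.
  by rewrite card_prod !card_tuple expnSr.
by rewrite (reindex h) //=; exact: onW_bij.
Qed.

Lemma of_digitsE w : of_digits w = \sum_(i < size w) teichF (nth 0 w i) * varpi ^+ i.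
Proof.
elim: w => [|t w IHw]; first by rewrite big_ord0.
rewrite /= big_ord_recl expr0 mulr1 /= IHw mulr_sumr; congr (_ + _).
by apply: eq_bigr => i _; rewrite exprS; ring.
Qed.

Lemma s_vertexE (n k : nat) : s n k =
  \sum_(mu : n.-tuple Fq) iota (last 0 mu) ^+ k *: br (vertex false mu).
Proof.
apply: eq_bigr => mu _; rewrite -nth_last size_tuple; congr (_ *: br _).
rewrite /vertex mul1g /half_vertex size_tuple; congr mat2.
rewrite of_digitsE size_tuple; apply: eq_bigr => i _.
by rewrite (tnth_nth 0).
Qed.

(** [s_n^k] and [beta s_n^k], according to [sg]. *)
Definition layer sg (n k : nat) : ind := act (side sg) (s n k).

Lemma layerE sg (n k : nat) : layer sg n k =
  \sum_(mu : n.-tuple Fq) iota (last 0 mu) ^+ k *: br (vertex sg mu).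
Proof.
rewrite /layer s_vertexE act_sum; apply: eq_bigr => mu _.
by rewrite act_scale act_br /vertex mul1g.
Qed.

Lemma vertex_sum_layer sg (n k : nat) sg' u : vertex_sum (layer sg n k) (vertex sg' u) =
  if (sg == sg') && (size u == n) then iota (last 0 u) ^+ k else 0.
Proof.
rewrite layerE vertex_sum_sum.
under eq_bigr do rewrite vertex_sum_scale vertex_sum_br.
have [_|ne] /= := eqVneq sg sg'; last by rewrite big1// => mu _; rewrite mulr0.
case: (eqVneq (size u) n) => [/eqP un|nun].
  rewrite (bigD1 (Tuple un))//= eqxx mulr1 big1 ?addr0// => mu ne.
  by rewrite (_ : _ == u = false) ?mulr0//; exact: negbTE.
rewrite big1// => mu _; rewrite (_ : _ == u = false) ?mulr0//.
by apply/negbTE; apply: contra nun => /eqP <-; rewrite size_tuple.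
Qed.

(** Reindexing by the permutation [hw] of the words, [h s - s] becomes a sum of
    [h g_mu], for the words [mu], with coefficients [- H ^ (p ^ l)] that depend
    only on the digits before the last.  The relations at the parents turn the
    sum over the last digit into minus the grandparent, whose coefficient is a
    sum over the last digit but one, zero by [sum_digit_moebius]. *)
Lemma s_inv h m l : h \in pro_p_iwahori v ->
  qpi T (act h (s m.+2 (p ^ l))) = qpi T (s m.+2 (p ^ l)).
Proof.
move=> /pro_pE[a [b [c [d [[a1 b0 c1 d1] hE]]]]].
pose M := moebius a b c d; pose hw w := digits (size w) (M (of_digits w)).
have hrepE w : exists2 k, k \in IZ v & (h * half_vertex w = half_vertex (hw w) * k)%g.
  by rewrite hE; exact: moebius_half_vertex.
have eh w : e (half_vertex (hw w)) = e (h * half_vertex w)%g.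
  by have [k kI ->] := hrepE w; rewrite e_KZ//; exact: IZ_KZ.
have sh w : size (hw w) = size w by exact: size_digits.
have ht (mu : m.+2.-tuple Fq) : size (hw mu) == m.+2 by rewrite sh size_tuple.
have hinj : injective (fun mu : m.+2.-tuple Fq => Tuple (ht mu)).
  move=> mu nu /(congr1 val) /= E; apply: val_inj => /=.
  have [k kI kE] := hrepE mu; have [k' k'I k'E] := hrepE nu.
  apply: (half_vertex_inj (k := (k'^-1 * k)%g)).
    by apply: IZ_KZ; apply: gpredM => //; rewrite gpredV.
  by apply: (@mulgI _ h); rewrite kE E mulgA k'E -mulgA mulVKg.
have vertex_f w : vertex false w = half_vertex w by rewrite /vertex mul1g.
rewrite s_vertexE act_sum !qpi_sum; apply/eqP; rewrite -subr_eq0; apply/eqP.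
rewrite [X in _ - X](reindex_inj hinj) -sumrB /=.
pose H w := digit (size w) (M (of_digits w)).
pose E u := (iota (last 0 u) ^+ (p ^ l) - iota (last 0 (hw u)) ^+ (p ^ l)) *:
  e (h * half_vertex u)%g.
transitivity (\sum_(mu : m.+2.-tuple Fq) E mu).
  apply: eq_bigr => mu _; rewrite act_scale act_br !qpi_scale !vertex_f eh.
  by rewrite /E scalerBl.
rewrite sum_tuple_rcons (sum_tuple_rcons _ (fun u => \sum_t E (rcons u t))).
apply: big1 => w _.
have EE s' t : E (rcons (rcons w s') t) = - (iota (H (rcons w s')) ^+ (p ^ l)) *:
    e (h * half_vertex (rcons w s') * child t)%g.
  rewrite /E /hw size_rcons (digits_moebius a1 b0 c1 d1) !last_rcons.
  rewrite rmorphD (Frobenius_additive p_prime (pchar_C iota p_prime card_Fq)).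
  by rewrite opprD addrCA subrr addr0 -mulgA half_vertex_child.
transitivity (\sum_s' (iota (H (rcons w s')) ^+ (p ^ l)) *: e (h * half_vertex w)%g).
  apply: eq_bigr => s' _; under eq_bigr do rewrite EE.
  rewrite -scaler_sumr scaleNr -scalerN; congr (_ *: _).
  apply/eqP; rewrite eq_sym -addr_eq0; apply/eqP.
  rewrite -[RHS](e_in_edges (h * half_vertex (rcons w s'))%g); congr (_ + _).
  have [k kKZ] := vertex_parent false w s'; rewrite (vertex_f (rcons w s')) (vertex_f w) => pk.
  by rewrite -[(h * _ * bet)%g]mulgA pk mulgA (e_KZ (h * half_vertex w)%g kKZ).
have frob0 : (0 : C) ^+ (p ^ l) = 0.
  by rewrite expr0n expn_eq0 (gtn_eqF (prime_gt0 p_prime)).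
rewrite -scaler_suml.
rewrite -(big_morph _ (Frobenius_additive p_prime (pchar_C iota p_prime card_Fq) l) frob0).
rewrite -rmorph_sum /= (eq_bigr (fun s' => digit (size w).+1 (M (of_digits (rcons w s'))))).
  rewrite sum_digit_moebius// rmorph0 frob0.
  by rewrite scale0r.
by move=> s' _; rewrite /H size_rcons.
Qed.

(** * The shape of invariant classes *)

Lemma layer_inv sg m l : inv (qpi T (layer sg m.+2 (p ^ l))).
Proof.
move=> h hP; rewrite tau_actE /layer actM.
have [h' h'P E] : exists2 h', h' \in pro_p_iwahori v & (h * side sg = side sg * h')%g.
  by case: sg => /=; [exact: pro_p_beta | exists h; rewrite // mulg1 mul1g].
rewrite E -actM; apply: qpi_act.
exact: s_inv.
Qed.

Lemma root_inv sg : inv (e (vertex sg [::])).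
Proof.
move=> h hP; rewrite tau_actE act_br.
have [w [k [sw kKZ ->]]] := pro_p_vertex sg [::] hP.
by rewrite (e_KZ _ kKZ) (size0nil sw).
Qed.

Lemma invB phi psi a : inv (qpi T phi) -> inv (qpi T psi) ->
  inv (qpi T (phi - a *: psi)).
Proof.
move=> iphi ipsi h hP; rewrite tau_actE actB act_scale !qpiB !qpi_scale.
by rewrite -!tau_actE iphi// ipsi.
Qed.

Lemma inv_sum (I : Type) (r : seq I) (a : I -> C) (E : I -> ind) phi :
  inv (qpi T phi) -> (forall i, inv (qpi T (E i))) ->
  inv (qpi T (phi - \sum_(i <- r) a i *: E i)).
Proof.
move=> iphi iE; elim: r => [|i r IHr]; first by rewrite big_nil subr0.
by rewrite big_cons opprD addrCA addrC; apply: invB.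
Qed.

Definition transl (sg : bool) (b : F) : GL2 F :=
  if sg then mat2 1 0 (varpi * b) 1 else mat2 1 b 0 1.

Lemma transl_pro_p sg b : vge v 0 b -> transl sg b \in pro_p_iwahori v.
Proof.
move=> b0; have o1 : oneunit v 1 by rewrite /oneunit /= subrr vge0.
case: sg => /=; apply: pro_p_mat2 => //; try exact: vge0.
by apply: vge10M => //; exact: vge_pi.
Qed.

Lemma det_upper (b : F) : 1 * 1 - b * 0 != 0.
Proof. by rewrite mulr0 subr0 mulr1 oner_neq0. Qed.

Lemma det_lower (b : F) : 1 * 1 - 0 * b != 0.
Proof. by rewrite mul0r subr0 mulr1 oner_neq0. Qed.

Lemma transl_side sg b : (transl sg b * side sg = side sg * mat2 1 b 0 1)%g.
Proof.
case: sg; rewrite /= ?mulg1 ?mul1g// /beta !mat2M ?det_beta ?det_upper ?det_lower//.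
by congr mat2; ring.
Qed.

Lemma translN sg b : (transl sg (- b) * transl sg b)%g = 1%g.
Proof.
by case: sg; rewrite /= mat2M ?det_upper ?det_lower// -mat2_1; congr mat2; ring.
Qed.

Lemma transl_vertex sg b w : (transl sg b * vertex sg w)%g =
  (side sg * mat2 (varpi ^+ size w) (of_digits w + b) 0 1)%g.
Proof.
have D : varpi ^+ size w * 1 - of_digits w * 0 != 0 by exact: det_half_vertex.
rewrite /vertex mulgA transl_side -mulgA; congr (_ * _)%g.
by rewrite /half_vertex mat2M ?det_upper//; congr mat2; ring.
Qed.

(** The variation of a representative is zero in [tau], hence in the image of the
    adjacency operator, which raises depths by one. *)
Lemma inv_diff n phi g g' : inv (qpi T phi) -> depth_le n.+1 (vertex_sum phi) ->
  g \in pro_p_iwahori v -> g' \in pro_p_iwahori v -> (g' * g = 1)%g ->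
  exists c, [/\ KZinv c, depth_le n c &
    forall y, vertex_sum phi (g * y)%g - vertex_sum phi y = adjacency c y].
Proof.
move=> iphi phin gP g'P g'g.
have g'V : (g'^-1 = g)%g by apply: (@mulgI _ g'); rewrite mulgV g'g.
have pE y : vertex_sum (act g' phi - phi) y = vertex_sum phi (g * y)%g - vertex_sum phi y.
  by rewrite vertex_sumB vertex_sum_act g'V.
have /qpi_eq0_adjacency : qpi T (act g' phi - phi) = 0.
  by rewrite qpiB -tau_actE iphi// subrr.
move=> [c [cKZ [m cm] cE]]; exists c; split=> //; last first.
  by move=> y; rewrite -cE pE.
apply: (adjacency_depth cKZ cm) => sg w nw; rewrite -cE pE phin// subr0.
have [w' [k [sw kKZ ->]]] := pro_p_vertex sg w gP.
by rewrite vertex_sum_KZ// phin// sw.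
Qed.

Section Layer.
Variables (n : nat) (phi : ind).
Hypotheses (iphi : inv (qpi T phi)) (phin : depth_le n.+1 (vertex_sum phi)).
Let z := nseq n (0 : Fq).

Let of_digits_z : of_digits z = 0.
Proof.
rewrite /z; elim: (n) => //= k ->.
by rewrite teichF0 add0r mulr0.
Qed.

Let size_z : size z = n. Proof. exact: size_nseq. Qed.

Let transl_z0 sg w t : size w = n ->
  (transl sg (of_digits w) * vertex sg (rcons z t))%g = vertex sg (rcons w t).
Proof.
move=> sw; rewrite transl_vertex; congr (_ * _)%g.
rewrite /half_vertex !size_rcons !of_digits_rcons sw size_z of_digits_z.
by congr mat2; ring.
Qed.

Let transl_zt sg (t u : Fq) : exists2 k, inKZ v k &
  (transl sg (varpi ^+ n * teichF u) * vertex sg (rcons z t) =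
   vertex sg (rcons z (t + u)) * k)%g.
Proof.
pose r := (teichF t + teichF u - teichF (t + u)) / varpi.
have r0 : vge v 0 r.
  have V x y : vge v 0 (teichF x + teichF y) by apply: vgeD; exact: vge0_teichF.
  apply: vge1_divpi; apply/residue_eq; rewrite ?vge0_teichF ?V//.
  by rewrite residueD ?vge0_teichF// !residue_teichF.
exists (mat2 1 r 0 1).
  by apply/IZ_KZ/IZ_intro1; rewrite ?vunit1 ?vge0.
have D : varpi ^+ n.+1 * 1 - of_digits (rcons z (t + u)) * 0 != 0.
  by rewrite mulr0 subr0 mulr1 expf_neq0.
rewrite transl_vertex /vertex -mulgA; congr (_ * _)%g.
rewrite /half_vertex !size_rcons size_z mat2M ?det_upper//.
rewrite !of_digits_rcons size_z of_digits_z; congr mat2; try ring.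
rewrite /r exprSr; field; by rewrite pi_neq0.
Qed.

Lemma layer_const sg g g' : g \in pro_p_iwahori v -> g' \in pro_p_iwahori v ->
  (g' * g = 1)%g -> forall w t, size w = n ->
  vertex_sum phi (g * vertex sg (rcons w t))%g - vertex_sum phi (vertex sg (rcons w t)) =
  vertex_sum phi (g * vertex sg (rcons w 0))%g - vertex_sum phi (vertex sg (rcons w 0)).
Proof.
move=> gP g'P g'g w t sw; have [c [cKZ cn cE]] := inv_diff iphi phin gP g'P g'g.
rewrite !cE !adjacency_rcons//; congr (_ + _).
by rewrite !big1// => u _; apply: cn; rewrite !size_rcons sw.
Qed.

(** The word [z] of zeros serves as base point. *)
Definition last_digit_part sg t :=
  vertex_sum phi (vertex sg (rcons z t)) - vertex_sum phi (vertex sg (rcons z 0)).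

(** Translation by [of_digits w] maps the words [z t] to the words [w t]; it changes
    the values by an amount independent of [t]. *)
Lemma last_digit_partP sg w t : size w = n ->
  vertex_sum phi (vertex sg (rcons w t)) =
  vertex_sum phi (vertex sg (rcons w 0)) + last_digit_part sg t.
Proof.
move=> sw; have b0 := vge0_of_digits w; have b0' := vgeN b0.
have := @layer_const sg _ _ (transl_pro_p sg b0) (transl_pro_p sg b0') (translN sg _) z t size_z.
rewrite !transl_z0// /last_digit_part => /eqP; rewrite subr_eq => /eqP ->.
by ring.
Qed.

(** Translation by [varpi ^+ n * teichF u] adds [u] to the last digit of [z t], and
    again changes the values by an amount independent of [t]. *)
Lemma last_digit_part_add sg : {morph last_digit_part sg : t u / t + u}.
Proof.
move=> t u; have b0 : vge v 0 (varpi ^+ n * teichF u).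
  by apply: vge0M; [apply: vge0X; exact: vge0_pi | exact: vge0_teichF].
have b0' := vgeN b0.
have := @layer_const sg _ _ (transl_pro_p sg b0) (transl_pro_p sg b0') (translN sg _) z t size_z.
have [k kKZ ->] := transl_zt sg t u; have [k' k'KZ] := transl_zt sg 0 u.
rewrite add0r => ->.
rewrite (vertex_sum_KZ _ _ kKZ) (vertex_sum_KZ _ _ k'KZ) /last_digit_part => /eqP.
rewrite subr_eq => /eqP ->.
by ring.
Qed.

End Layer.

(** The variation under a translation of the half [sg] is the image under the
    adjacency operator of a function [c] supported on the two roots.  At depth one
    of the half [sg] it takes the value of [c] at the root of this half.  It takes
    the same value at the opposite root, which the translation fixes, so this
    value is zero. *)
Lemma last_digit_part0 phi sg t : inv (qpi T phi) -> depth_le 1 (vertex_sum phi) ->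
  last_digit_part 0 phi sg t = 0.
Proof.
move=> iphi phi1; have b0 := vge0_teichF t; have b0' := vgeN b0.
have [c [cKZ c0 cE]] := inv_diff iphi phi1 (transl_pro_p sg b0)
  (transl_pro_p sg b0') (translN sg _).
have c_root : c (vertex sg [::]) = 0.
  have := cE (vertex (~~ sg) [::]); rewrite adjacency_nil// negbK big1 => [|u _].
    rewrite addr0 => <-.
    have [w [k [sw kKZ ->]]] := pro_p_vertex (~~ sg) [::] (transl_pro_p sg b0).
    by rewrite vertex_sum_KZ// (size0nil sw) subrr.
  exact: c0.
have := cE (vertex sg (rcons [::] 0)); rewrite adjacency_rcons// c_root.
rewrite big1 => [|u _]; last exact: c0.
rewrite addr0 /last_digit_part /= => <-; congr (vertex_sum phi _ - _).
rewrite transl_vertex /vertex /half_vertex /= teichF0; congr (_ * mat2 _ _ _ _)%g.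
by ring.
Qed.

(** * A basis of the invariants *)

Local Notation J := (bool + bool * (nat * 'I_f))%type.

Definition lift_family (j : J) : ind :=
  match j with
  | inl sg => br (vertex sg [::])
  | inr (sg, (m, l)) => layer sg m.+2 (p ^ l)
  end.

Lemma tau_familyE j : tau_family varpi teich T iota p j = qpi T (lift_family j).
Proof.
case: j => [[]|[[] [m l]]] //=; congr (qpi T _); rewrite ?vertex_nil//.
by apply: ev_eq => g; rewrite /layer ev_act /= invg1 mul1g.
Qed.

Lemma lift_family_inv j : inv (qpi T (lift_family j)).
Proof.
case: j => [sg|[sg [m l]]] /=.
  exact: root_inv.
exact: layer_inv.
Qed.

Lemma vertex_sum_lift j sg u : vertex_sum (lift_family j) (vertex sg u) =
  match j with
  | inl sg' => ((sg' == sg) && (u == [::]))%:R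
  | inr (sg', (m, l)) =>
      if (sg' == sg) && (size u == m.+2) then iota (last 0 u) ^+ (p ^ l) else 0
  end.
Proof.
case: j => [sg'|[sg' [m l]]] /=; first by rewrite vertex_sum_br [[::] == u]eq_sym.
exact: vertex_sum_layer.
Qed.

Definition spanned (x : tau T) := exists (r : seq J) (c : J -> C),
  uniq r /\ x = \sum_(j <- r) c j *: qpi T (lift_family j).

Lemma spanned0 : spanned 0.
Proof. by exists [::], (fun=> 0); rewrite big_nil. Qed.

Lemma spannedD x a j : spanned x -> spanned (x + a *: qpi T (lift_family j)).
Proof.
move=> [r [c [ur ->]]]; have [jr|njr] := boolP (j \in r).
  exists r, (fun i => if i == j then c j + a else c i); split=> //.
  rewrite !(bigD1_seq j)//= eqxx scalerDl addrAC; congr (_ + _).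
  by apply: eq_bigr => i /negPf ->.
exists (j :: r), (fun i => if i == j then a else c i); rewrite /= njr; split=> //.
rewrite big_cons eqxx addrC; congr (_ + _); apply: eq_big_seq => i ir.
by case: eqVneq => // E; rewrite E (negPf njr) in ir.
Qed.

Lemma spanned_sum (I : Type) (r : seq I) (a : I -> C) (h : I -> J) x : spanned x ->
  spanned (x + \sum_(i <- r) a i *: qpi T (lift_family (h i))).
Proof.
elim: r x => [|i r IHr] x sx; first by rewrite big_nil addr0.
by rewrite big_cons addrA; apply: IHr; exact: spannedD.
Qed.

Lemma invariants_spanned n phi : inv (qpi T phi) -> depth_le n (vertex_sum phi) ->
  spanned (qpi T phi).
Proof.
have red := reduce_depth.
elim: n phi => [|[|m] IHn] phi iphi phin.
- pose a sg := vertex_sum phi (vertex sg [::]).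
  suff E : qpi T (phi - \sum_sg a sg *: lift_family (inl sg)) = 0.
    move/eqP: E; rewrite qpiB subr_eq0 => /eqP->; rewrite qpi_sum -[X in spanned X]add0r.
    under eq_bigr do rewrite qpi_scale.
    exact: spanned_sum spanned0.
  apply: vertex_sum_eq0 => sg w.
  rewrite vertex_sumB vertex_sum_sum (bigD1 sg)//= big1 => [|sg' ne]; last first.
    by rewrite vertex_sum_scale (vertex_sum_lift (inl sg')) (negPf ne) mulr0.
  rewrite addr0 vertex_sum_scale (vertex_sum_lift (inl sg)) eqxx /=.
  case: w => [|t w]; first by rewrite mulr1 subrr.
  by rewrite phin// mulr0 subrr.
- have [|psi E psi0] := red 0%N phi (fun sg w => vertex_sum phi (vertex sg (rcons w 0))) phin.
    move=> sg w t sw.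
    rewrite (last_digit_partP iphi phin sg t sw).
    rewrite (last_digit_part0 sg t iphi phin).
    by rewrite addr0.
  by rewrite -E; apply: IHn => //; rewrite E.
- have P := last_digit_partP iphi phin.
  have A sg := additive_fun_Frobenius iota p_prime card_Fq
    (last_digit_part_add iphi phin sg).
  have [a aP] : exists a : bool -> 'I_f -> C, forall sg t,
      last_digit_part m.+1 phi sg t = \sum_(l < f) a sg l * iota t ^+ (p ^ l).
    have [a1 a1P] := A true; have [a2 a2P] := A false.
    by exists (fun sg => if sg then a1 else a2) => -[].
  pose D := \sum_(x : bool * 'I_f) a x.1 x.2 *: lift_family (inr (x.1, (m, x.2))).
  have DE sg w : vertex_sum D (vertex sg w) =
      if size w == m.+2 then \sum_(l < f) a sg l * iota (last 0 w) ^+ (p ^ l) else 0.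
    rewrite vertex_sum_sum (eq_bigr (fun x : bool * 'I_f => if (x.1 == sg) && (size w == m.+2)
        then a x.1 x.2 * iota (last 0 w) ^+ (p ^ x.2) else 0)); last first.
      move=> x _; rewrite vertex_sum_scale (vertex_sum_lift (inr (x.1, (m, x.2)))).
      by case: ifP => _ //; rewrite mulr0.
    rewrite -(pair_bigA _ (fun sg' l => if (sg' == sg) && (size w == m.+2)
        then a sg' l * iota (last 0 w) ^+ (p ^ l) else 0)) /= (bigD1 sg)//= eqxx /=.
    rewrite [X in _ + X]big1 ?addr0 => [|sg' /negPf ne]; last by rewrite big1// => l _; rewrite ne.
    by case: ifP => // _; rewrite big1.
  have [||psi E psin] := red m.+1 (phi - D) (fun sg w => vertex_sum phi (vertex sg (rcons w 0))).
  + move=> sg w mw; rewrite vertex_sumB DE gtn_eqF// subr0; exact: phin.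
  + by move=> sg w t sw; rewrite vertex_sumB DE size_rcons sw eqxx P// aP last_rcons addrK.
  have : spanned (qpi T psi).
    apply: IHn => //; rewrite E; apply: inv_sum => // x.
    exact: lift_family_inv.
  rewrite E qpiB => /(spanned_sum (index_enum _) (fun x => a x.1 x.2)
     (fun x : bool * 'I_f => inr (x.1, (m, x.2)))).
  rewrite qpi_sum; under [X in _ + X]eq_bigr do rewrite -qpi_scale.
  by rewrite subrK.
Qed.

Lemma sum_codom (I : finType) (h : I -> J) (r : seq J) (G : J -> C) : injective h ->
  uniq r -> (forall j, (forall i, j != h i) -> G j = 0) ->
  \sum_(j <- r) G j = \sum_i (if h i \in r then G (h i) else 0).
Proof.
move=> h_inj ur G0.
transitivity (\sum_(j <- r) \sum_i (if j == h i then G j else 0)).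
  apply: eq_bigr => j _; have [[i ->]|nj] := pselect (exists i, j = h i).
    rewrite (bigD1 i)//= eqxx big1 ?addr0// => i' i'i.
    by rewrite (inj_eq h_inj) eq_sym (negPf i'i).
  rewrite G0 => [|i]; last by apply/eqP => E; apply: nj; exists i.
  by rewrite big1// => i _; case: eqP => // E; case: nj; exists i.
rewrite exchange_big; apply: eq_bigr => i _; case: ifP => [hr|nhr].
  rewrite (bigD1_seq (h i))//= eqxx big1 ?addr0// => j.
  by move/negPf ->.
rewrite big1_seq// => j /andP[_ jr]; case: eqP => // E.
by rewrite -E jr in nhr.
Qed.

(** The functions of the family vanish on words of positive length ending in zero,
    so [adjacency_inj] turns a relation in [tau] into a relation between
    functions.  Those of different depth or side have disjoint supports. *)
Lemma family_free (r : seq J) (c : J -> C) : uniq r ->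
  \sum_(j <- r) c j *: qpi T (lift_family j) = 0 -> forall j, j \in r -> c j = 0.
Proof.
move=> ur E; pose phi := \sum_(j <- r) c j *: lift_family j.
have {}E : qpi T phi = 0.
  by rewrite -E qpi_sum; apply: eq_bigr => j _; rewrite qpi_scale.
have phiE sg w : vertex_sum phi (vertex sg w) =
    \sum_(j <- r) c j * vertex_sum (lift_family j) (vertex sg w).
  by rewrite vertex_sum_sum; apply: eq_bigr => j _; rewrite vertex_sum_scale.
have phi0 sg w : vertex_sum phi (vertex sg w) = 0.
  have [b [bKZ [m bm] bE]] := qpi_eq0_adjacency E.
  have b0 sg' w' : b (vertex sg' w') = 0.
    apply: (adjacency_inj (n := 0) bKZ bm) => // {}sg {}w _; exists 0.
    rewrite -bE phiE big1// => -[sg''|[sg'' [n l]]] _; rewrite vertex_sum_lift.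
      by case: (w) => [|? ?]; rewrite /= andbF mulr0.
    rewrite last_rcons rmorph0 expr0n expn_eq0 (gtn_eqF (prime_gt0 p_prime)) /=.
    by rewrite if_same mulr0.
  rewrite bE; case/lastP: w => [|w t].
    by rewrite adjacency_nil// b0 big1 ?addr0.
  by rewrite adjacency_rcons// b0 big1 ?addr0.
case=> [sg|[sg [m l]]] jr.
  have := phi0 sg [::]; rewrite phiE (bigD1_seq _ jr ur) vertex_sum_lift !eqxx mulr1 /=.
  rewrite big1 ?addr0 => [//|[sg'|[sg' [n k]]] ne]; rewrite vertex_sum_lift.
    by rewrite (_ : sg' == sg = false) ?mulr0//; apply: contraNF ne => /eqP ->.
  by rewrite /= andbF mulr0.
pose h (k : 'I_f) : J := inr (sg, (m, k)).
have h_inj : injective h by move=> k k' [].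
pose a (i : 'I_f) := if h i \in r then c (h i) else 0.
suff /(_ l) : forall i, a i = 0 by rewrite /a jr.
apply: (Frobenius_free (iota := iota) p_prime card_Fq) => t.
have := phi0 sg (rcons (nseq m.+1 0) t); rewrite phiE (sum_codom h_inj ur) => [E0|].
  apply: etrans E0; apply: eq_bigr => k _; rewrite /a; case: ifP => _; last by rewrite mul0r.
  by rewrite /h vertex_sum_lift eqxx size_rcons size_nseq eqxx last_rcons.
case=> [sg'|[sg' [n k]]] jh; rewrite vertex_sum_lift.
  by rewrite (_ : rcons _ _ == [::] = false) ?andbF ?mulr0//; case: (m).
rewrite size_rcons size_nseq; case: ifP => [/andP[/eqP E1 /eqP[E2]]|_]; last by rewrite mulr0.
by have := jh k; rewrite /h -E2 E1 eqxx.
Qed.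

Lemma tau_basis : is_basis inv (tau_family varpi teich T iota p (f := f)).
Proof.
split=> [j|r c ur|x ix].
- by rewrite tau_familyE; exact: lift_family_inv.
- under eq_bigr do rewrite tau_familyE.
  exact: family_free.
rewrite -(qpi_repr x) in ix *.
have [n nP] := vertex_sum_depth (repr x).
have [r [c [_ ->]]] := invariants_spanned ix nP.
by exists r, c; apply: eq_bigr => j _; rewrite tau_familyE.
Qed.

End Tree.

(** * Invariants over a local field *)

(** On the rationals the valuation of [F] is [e] times the p-adic one. *)
Lemma valuation_card_residue (p : nat) (Qp : fieldType) (vp : valuation Qp)
  (F : fieldExtType Qp) (v : valuation F) (e n : nat) :
  prime p -> is_Qp p vp -> has_ramification_index vp v e ->
  v (p ^ n)%:R = (e * n)%:Z.
Proof.
move=> p_prime [char0 vrat _ _] ram.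
have pN0 : p%:R != 0 :> Qp.
  have /pcharf0P -> := char0; by rewrite (gtn_eqF (prime_gt0 p_prime)).
have vpp : vp p%:R = 1.
  have := vrat p%:R; rewrite ratr_nat => ->; last first.
    by rewrite pnatr_eq0 (gtn_eqF (prime_gt0 p_prime)).
  rewrite /rat_val -[p%:R]/(p%:Z%:~R) numq_int denq_int /=.
  by rewrite logn_prime// eqxx logn1.
have vp_F : v p%:R = e%:Z.
  by have := ram _ pN0; rewrite vpp mulr1 => <-; rewrite scaler_nat.
have pF : p%:R != 0 :> F.
  by rewrite -scaler_nat scaler_eq0 negb_or pN0 oner_neq0.
by rewrite natrX valuationX// vp_F PoszM.
Qed.

Theorem theorem2p1 (p : nat) (Qp : fieldType) (vp : valuation Qp)
  (F : fieldExtType Qp) (v : valuation F) (e f : nat) (varpi : F)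
  (Fq : finFieldType) (res : {rmorphism integers v -> Fq})
  (teich : Fq -> integers v)
  (Fpbar : closedFieldType) (inc : {rmorphism 'F_p -> Fpbar})
  (iota : {rmorphism Fq -> Fpbar})
  (T12 : {linear ind v Fpbar -> ind v Fpbar}) :
  prime p -> is_Qp p vp ->
  is_uniformizer v varpi -> has_ramification_index vp v e ->
  is_residue_map res -> #|Fq| = (p ^ f)%N -> is_teichmuller res teich ->
  integralRange inc ->
  is_T12 varpi teich T12 ->
  (1 < e * f)%N -> (3 < p ^ f)%N ->
  is_basis (tau_invariants (T := T12) (pro_p_iwahori v))
           (tau_family varpi teich T12 iota p (f := f)).
Proof.
move=> p_prime QpP [pi_neq0 v_pi] ram [_ res_ker] card_Fq [teichK teichM] _ T12P ef q3.
have q2 : vge v 2 (#|Fq|%:R : F).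
  by rewrite /vge /= card_Fq (valuation_card_residue _ p_prime QpP ram) lez_nat ef orbT.
rewrite -card_Fq in q3.
exact: (tau_basis pi_neq0 v_pi res_ker teichK teichM q2 q3 iota p_prime card_Fq T12P).
Qed.
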